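(* Let $\mathfrak g$ be a definable Lie ring of finite dimension. Then the Radical ideal $R(\mathfrak g)$ is soluble and definable.
   Context: A first-order theory $T$ is finite-dimensional if there is a function $\dim$ from the class of all interpretable sets in models of $T$ to $\omega\cup\{-\infty\}$ such that, for every formula $\varphi(x,y)$, all interpretable sets $X,Y$ and every interpretable function $f:X\to Y$: (1) if $a,a'$ have the same type over $\emptyset$ then $\dim\varphi(x,a)=\dim\varphi(x,a')$; (2) $\dim\emptyset=-\infty$, and $\dim X=0$ iff $X$ is finite (nonempty); (3) $\dim(X\cup Y)=\max\{\dim X,\dim Y\}$; (4) if $\dim f^{-1}(y)\ge k$ for all $y\in Y$ then $\dim X\ge \dim Y+k$; (5) if $\dim f^{-1}(y)\le k$ for all $y\in Y$ then $\dim X\le\dim Y+k$. A definable Lie ring ''of finite dimension'' is one definable in (a model of) a finite-dimensional theory. A Lie ring is an abelian group $(\mathfrak g,+)$ with a biadditive antisymmetric bracket satisfying the Jacobi identity. The Radical ideal $R(\mathfrak g)$ is the sum of all soluble ideals of $\mathfrak g$ (definable or not). *)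

(* Defs.v *)
From HB Require Import structures.
From mathcomp Require Import all_boot all_algebra.
From mathcomp Require Import all_classical.

Set Implicit Arguments.
Unset Strict Implicit.
Unset Printing Implicit Defensive.

Import GRing.Theory.

Local Open Scope classical_set_scope.

(** * First-order logic *)

Record language := Language {
  func : Type;
  func_arity : func -> nat;
  pred_sym : Type;
  pred_arity : pred_sym -> nat }.

(* Well-scoped de Bruijn syntax: the free variables of a [term L n] or a
   [formula L n] are among the elements of ['I_n]. *)
Inductive term (L : language) (n : nat) : Type :=
| Var of 'I_n
| App (f : func L) of ('I_(func_arity f) -> term L n).

Inductive formula (L : language) : nat -> Type :=
| Falsum n : formula L n
| Equal n of term L n & term L n : formula L n
| Atom n (r : pred_sym L) of ('I_(pred_arity r) -> term L n) : formula L n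
| Imp n of formula L n & formula L n : formula L n
| All n of formula L n.+1 : formula L n.

Record structure (L : language) := Structure {
  carrier :> Type;
  carrier_nonempty : inhabited carrier;
  func_interp : forall f : func L, (func_arity f).-tuple carrier -> carrier;
  pred_interp :
    forall r : pred_sym L, (pred_arity r).-tuple carrier -> Prop }.

Fixpoint eval (L : language) (M : structure L) (n : nat) (e : n.-tuple M)
    (t : term L n) : M :=
  match t with
  | Var i => tnth e i
  | App f ts =>
      func_interp [tuple eval e (ts i) | i < func_arity f]
  end.

(* The variable bound by [All] is variable 0; the others are shifted. *)
Fixpoint sat (L : language) (M : structure L) (n : nat) (phi : formula L n) :
    n.-tuple M -> Prop :=
  match phi with
  | Falsum _ => fun _ => False
  | Equal _ t u => fun e => eval e t = eval e u
  | Atom _ r ts => fun e => pred_interp [tuple eval e (ts i) | i < pred_arity r]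
  | Imp _ p q => fun e => sat p e -> sat q e
  | All _ p => fun e => forall x : M, sat p (cons_tuple x e)
  end.

Definition theory (L : language) := set (formula L 0).

Definition is_model (L : language) (T : theory L) (M : structure L) : Prop :=
  forall phi, T phi -> sat phi [tuple of ([::] : seq M)].

Definition same_type (L : language) (M N : structure L) (m : nat)
    (a : m.-tuple M) (b : m.-tuple N) : Prop :=
  forall phi : formula L m, sat phi a <-> sat phi b.

(** * Definable and interpretable sets (with parameters) *)

Definition def_set (L : language) (M : structure L) (n m : nat)
    (phi : formula L (n + m)) (a : m.-tuple M) : set (n.-tuple M) :=
  [set x | sat phi (cat_tuple x a)].

Definition definable (L : language) (M : structure L) (n : nat)
    (A : set (n.-tuple M)) : Prop :=
  exists (m : nat) (phi : formula L (n + m)) (a : m.-tuple M),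
    A = def_set phi a.

Definition equivalence_on (T : Type) (D : set T) (E : T -> T -> Prop) : Prop :=
  [/\ forall x, D x -> E x x,
      forall x y, D x -> D y -> E x y -> E y x
    & forall x y z, D x -> D y -> D z -> E x y -> E y z -> E x z].

Definition quotient_set (T : Type) (D : set T) (E : T -> T -> Prop) :
    set (set T) :=
  [set [set y | D y /\ E x y] | x in D].

Definition def_rel (L : language) (M : structure L) (n m : nat)
    (eps : formula L (n + n + m)) (a : m.-tuple M) (x y : n.-tuple M) : Prop :=
  def_set eps a (cat_tuple x y).

(* An interpretable set is the set of classes of a definable equivalence
   relation on a definable set; a definable set is identified with the
   corresponding set of singletons (quotient by equality). *)
Definition interpretable (L : language) (M : structure L) (n : nat)
    (X : set (set (n.-tuple M))) : Prop :=
  exists (m : nat) (delta : formula L (n + m)) (eps : formula L (n + n + m))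
         (a : m.-tuple M),
    equivalence_on (def_set delta a) (def_rel eps a) /\
    X = quotient_set (def_set delta a) (def_rel eps a).

(* [f] restricted to [X] is an interpretable function from [X] to [Y]: its
   graph, pulled back to tuples of elements of [M], is definable. *)
Definition interpretable_fun (L : language) (M : structure L) (n p : nat)
    (X : set (set (n.-tuple M))) (Y : set (set (p.-tuple M)))
    (f : set (n.-tuple M) -> set (p.-tuple M)) : Prop :=
  (forall A, X A -> Y (f A)) /\
  definable (\bigcup_(A in X) [set cat_tuple u v | u in A & v in f A]).

(** * Finite-dimensional theories *)

(* Elements of omega together with -oo, the latter being [None]. *)
Definition dimension := option nat.

Definition dim_le (d e : dimension) : bool :=
  match d, e with
  | None, _ => true
  | Some _, None => false
  | Some i, Some j => (i <= j)%N
  end.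

Definition dim_max (d e : dimension) : dimension :=
  if dim_le d e then e else d.

Definition dim_add (d : dimension) (k : nat) : dimension :=
  omap (fun i => (i + k)%N) d.

(* [dim] only matters on interpretable sets in models of [T].  In
   [dim_invariant] the tuples may lie in different models, and the formula
   phi(x,y), with [x] in a sort of imaginaries, is given by [delta] (a set) and
   [eps] (an equivalence relation on it).  In [dim_union] the assumption that
   the union is interpretable means that [X] and [Y] lie in one sort. *)
Record is_dimension (L : language) (T : theory L)
    (dim : forall (M : structure L) (n : nat),
       set (set (n.-tuple M)) -> dimension) : Prop := IsDimension {
  dim_invariant : forall (M N : structure L) (n m : nat)
      (delta : formula L (n + m)) (eps : formula L (n + n + m))
      (a : m.-tuple M) (b : m.-tuple N),
    is_model T M -> is_model T N -> same_type a b ->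
    equivalence_on (def_set delta a) (def_rel eps a) ->
    equivalence_on (def_set delta b) (def_rel eps b) ->
    dim M n (quotient_set (def_set delta a) (def_rel eps a)) =
    dim N n (quotient_set (def_set delta b) (def_rel eps b));
  dim_empty : forall (M : structure L) (n : nat),
    is_model T M -> dim M n set0 = None;
  dim_zero : forall (M : structure L) (n : nat) (X : set (set (n.-tuple M))),
    is_model T M -> interpretable X ->
    (dim M n X = Some 0%N <-> finite_set X /\ X !=set0);
  dim_union : forall (M : structure L) (n : nat) (X Y : set (set (n.-tuple M))),
    is_model T M -> interpretable X -> interpretable Y ->
    interpretable (X `|` Y) ->
    dim M n (X `|` Y) = dim_max (dim M n X) (dim M n Y);
  dim_fibre_ge : forall (M : structure L) (n p : nat)
      (X : set (set (n.-tuple M))) (Y : set (set (p.-tuple M)))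
      (f : set (n.-tuple M) -> set (p.-tuple M)) (k : nat),
    is_model T M -> interpretable X -> interpretable Y ->
    interpretable_fun X Y f ->
    (forall B, Y B -> dim_le (Some k) (dim M n (X `&` f @^-1` [set B]))) ->
    dim_le (dim_add (dim M p Y) k) (dim M n X);
  dim_fibre_le : forall (M : structure L) (n p : nat)
      (X : set (set (n.-tuple M))) (Y : set (set (p.-tuple M)))
      (f : set (n.-tuple M) -> set (p.-tuple M)) (k : nat),
    is_model T M -> interpretable X -> interpretable Y ->
    interpretable_fun X Y f ->
    (forall B, Y B -> dim_le (dim M n (X `&` f @^-1` [set B])) (Some k)) ->
    dim_le (dim M n X) (dim_add (dim M p Y) k) }.

Definition finite_dimensional (L : language) (T : theory L) : Prop :=
  exists dim : forall (M : structure L) (n : nat),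
      set (set (n.-tuple M)) -> dimension,
    is_dimension T dim.

(** * Lie rings *)

Local Open Scope ring_scope.

HB.mixin Record Zmodule_isLieRing g of GRing.Zmodule g := {
  bracket : g -> g -> g;
  bracketDl : forall x y z : g, bracket (x + y) z = bracket x z + bracket y z;
  bracketDr : forall x y z : g, bracket x (y + z) = bracket x y + bracket x z;
  bracketC : forall x y : g, bracket x y = - bracket y x;
  bracket_jacobi : forall x y z : g,
    bracket x (bracket y z) + bracket y (bracket z x)
      + bracket z (bracket x y) = 0 }.

#[short(type="lieRingType")]
HB.structure Definition LieRing := { g of Zmodule_isLieRing g & GRing.Zmodule g }.

Definition additive_subgroup (g : zmodType) (A : set g) : Prop :=
  A 0 /\ forall x y, A x -> A y -> A (x - y).

Definition ideal (g : lieRingType) (I : set g) : Prop :=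
  additive_subgroup I /\ forall x y : g, I y -> I (bracket x y).

Definition bracket_set (g : lieRingType) (A B : set g) : set g :=
  smallest (@additive_subgroup g) [set bracket x y | x in A & y in B].

Fixpoint derived_series (g : lieRingType) (A : set g) (k : nat) : set g :=
  if k is k'.+1
  then bracket_set (derived_series A k') (derived_series A k') else A.

Definition soluble (g : lieRingType) (A : set g) : Prop :=
  exists k, derived_series A k = [set 0].

Definition radical (g : lieRingType) : set g :=
  [set x | exists s : seq g,
     (forall y, y \in s -> exists I : set g, [/\ ideal I, soluble I & I y]) /\
     x = \sum_(y <- s) y].
Arguments radical : clear implicits.

(* [c] identifies [g] with a Lie ring whose underlying set is a definable
   subset of [M^n] and whose operations have definable graphs. *)
Definition definable_lie_ring (L : language) (M : structure L) (n : nat)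
    (g : lieRingType) (c : g -> n.-tuple M) : Prop :=
  [/\ injective c,
      definable (range c),
      definable [set cat_tuple (cat_tuple (c x) (c y)) (c (x + y))
                | x in [set: g] & y in [set: g]]
    & definable [set cat_tuple (cat_tuple (c x) (c y)) (c (bracket x y))
                | x in [set: g] & y in [set: g]]].

(* Main.v *)
(* For an ideal [I], say that [x] almost centralizes [H] modulo [I] when
   [{y in H | [x, y] in I}] has finite index in [H].  The dimension drops when
   passing to a definable subgroup of infinite index, so a definable soluble
   ideal [I] of maximal dimension has finite index in every larger one.
   Compactness (an ultrapower) turns this into a uniform bound on the finite
   indices in a definable family of subgroups; hence almost centralizers are
   definable, and an ideal [A] that almost centralizes itself modulo [I] has, as
   in B. H. Neumann's theorem, finitely many brackets modulo [I].  Then the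
   centralizer of [[A, A]] in [A] modulo [I] is soluble of finite index in [A],
   so [A/I] is finite.  This applies to the almost centralizer [Z] of the whole
   ring.  For a soluble ideal [J], going up its derived series, one may assume
   [[J, J] <= Z]; a minimal finite intersection [H] of the centralizers modulo
   [I] of elements of [J], its almost centralizer [Y] and the almost centralizer
   [W] of [Y] give an ideal [W & Y] that is finite over [I] and contains [J] up
   to finite index, whence [J <= Z].  So the radical lies between [I] and [Z];
   being finite over [I], it is definable, and it is a sum of finitely many
   soluble ideals. *)
Require Import Defs.
From mathcomp Require Import all_boot all_algebra.
From mathcomp Require Import all_classical.

Set Implicit Arguments.
Unset Strict Implicit.
Unset Printing Implicit Defensive.

Import GRing.Theory.

Local Open Scope classical_set_scope.
Local Open Scope ring_scope.

(** * Renaming of variables *)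

Fixpoint rent (L : language) (n m : nat) (s : 'I_n -> 'I_m) (t : term L n) :
    term L m :=
  match t with
  | Var i => Var L (s i)
  | App f ts => App (fun i => rent s (ts i))
  end.

Definition lift_ren (n m : nat) (s : 'I_n -> 'I_m) : 'I_n.+1 -> 'I_m.+1 :=
  fun i => oapp (fun j => lift ord0 (s j)) ord0 (unlift ord0 i).

(** The target scope and the renaming come after the formula because both change under [All]. *)
Fixpoint renf (L : language) (n : nat) (phi : formula L n) :
    forall m, ('I_n -> 'I_m) -> formula L m :=
  match phi with
  | Falsum _ => fun m s => Falsum L m
  | Equal _ t u => fun m s => Equal (rent s t) (rent s u)
  | Atom _ r ts => fun m s => Atom (fun i => rent s (ts i))
  | Imp _ p q => fun m s => Imp (renf p s) (renf q s)
  | All _ p => fun m s => All (renf p (lift_ren s))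
  end.

Section Renaming.
Variables (L : language) (M : structure L).

Lemma eval_rent (n m : nat) (s : 'I_n -> 'I_m) (t : term L n) (e : m.-tuple M) :
  eval e (rent s t) = eval [tuple tnth e (s i) | i < n] t.
Proof.
elim: t => [i|f ts IH] /=; first by rewrite tnth_mktuple.
by congr func_interp; apply: eq_from_tnth => i; rewrite !tnth_mktuple IH.
Qed.

Lemma sat_renf (n : nat) (phi : formula L n) (m : nat) (s : 'I_n -> 'I_m)
    (e : m.-tuple M) :
  sat (renf phi s) e <-> sat phi [tuple tnth e (s i) | i < n].
Proof.
elim: phi m s e => {n} [n|n t u|n r ts|n p IHp q IHq|n p IHp] m s e //=.
- by rewrite !eval_rent.
- rewrite (_ : [tuple _ | i < _] =
    [tuple eval [tuple tnth e (s j) | j < n] (ts i) | i < pred_arity r]) //.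
  by apply: eq_from_tnth => i; rewrite !tnth_mktuple eval_rent.
- by rewrite IHp IHq.
- suff E x : [tuple tnth (cons_tuple x e) (lift_ren s i) | i < n.+1] =
      cons_tuple x [tuple tnth e (s i) | i < n].
    by split=> H x; have := H x; rewrite IHp E.
  apply: eq_from_tnth => i; rewrite tnth_mktuple /lift_ren.
  case: unliftP => [j|] -> /=; last by rewrite !tnth0.
  by rewrite !tnthS tnth_mktuple.
Qed.

End Renaming.

(** * Definable predicates on valuations *)

Definition valuation (I N : Type) (e : I -> N) (v : I + N) : N :=
  match v with inl i => e i | inr a => a end.

(* [P] is given by a formula each of whose free variables stands for one of the
   variables [I] or for a parameter.  Neither the sort nor the list of
   parameters is fixed, so renaming variables leaves the formula alone. *)
Definition dpred (L : language) (N : structure L) (I : Type)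
    (P : (I -> N) -> Prop) : Prop :=
  exists (K : nat) (phi : formula L K) (s : 'I_K -> I + N),
    forall e, P e <-> sat phi [tuple valuation e (s i) | i < K].

Section DefinablePredicates.
Variables (L : language) (N : structure L).

Lemma dpred_ext (I : Type) (P Q : (I -> N) -> Prop) :
  (forall e, P e <-> Q e) -> dpred P -> dpred Q.
Proof. by move=> PQ [K [phi [s H]]]; exists K, phi, s => e; rewrite -PQ. Qed.

Lemma dpred_subst (I J : Type) (P : (I -> N) -> Prop) (s : I -> J + N) :
  dpred P -> dpred (fun e => P (fun i => valuation e (s i))).
Proof.
case=> K [phi [t H]].
exists K, phi, (fun i => sum_rect (fun=> (J + N)%type) s inr (t i)) => e.
rewrite H (_ : [tuple _ | i < K] =
  [tuple valuation e
     (sum_rect (fun=> (J + N)%type) s inr (t i)) | i < K]) //.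
by apply: eq_from_tnth => i; rewrite !tnth_mktuple; case: (t i).
Qed.

Lemma dpred_ren (I J : Type) (P : (I -> N) -> Prop) (s : I -> J) :
  dpred P -> dpred (fun e => P (e \o s)).
Proof. exact: (@dpred_subst I J P (fun i => inl (s i))). Qed.

Lemma dpred_False (I : Type) : dpred (fun _ : I -> N => False).
Proof.
exists 0%N, (Falsum L 0).
by exists (fun i : 'I_0 => match i with Ordinal _ h => match notF h with end end).
Qed.

(** The two formulas have different scopes; both are renamed into the concatenation of these scopes,
    and the assignments of their variables are glued. *)
Lemma dpred_imp (I : Type) (P Q : (I -> N) -> Prop) :
  dpred P -> dpred Q -> dpred (fun e => P e -> Q e).
Proof.
move=> [K [phi [s H]]] [K' [psi [t H']]].
exists (K + K')%N.
exists (Imp (renf phi (@lshift K K')) (renf psi (@rshift K K'))).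
exists (fun i => match fintype.split i with inl j => s j | inr j => t j end) => e /=.
rewrite !sat_renf H H'.
rewrite (_ : [tuple _ | i < K] =
  [tuple valuation e (s i) | i < K]); last first.
  by apply: eq_from_tnth => i; rewrite !tnth_mktuple (unsplitK (inl _ i)).
rewrite (_ : [tuple _ | i < K'] =
  [tuple valuation e (t i) | i < K']) //.
by apply: eq_from_tnth => i; rewrite !tnth_mktuple (unsplitK (inr _ i)).
Qed.

Lemma dpred_not (I : Type) (P : (I -> N) -> Prop) :
  dpred P -> dpred (fun e => ~ P e).
Proof. by move=> dP; apply: dpred_imp => //; exact: dpred_False. Qed.

Lemma dpred_True (I : Type) : dpred (fun _ : I -> N => True).
Proof. by apply: dpred_ext (dpred_not (dpred_False I)) => e; split=> // _ []. Qed.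

Lemma dpred_or (I : Type) (P Q : (I -> N) -> Prop) :
  dpred P -> dpred Q -> dpred (fun e => P e \/ Q e).
Proof.
move=> dP dQ; apply: dpred_ext (dpred_imp (dpred_not dP) dQ) => e.
split=> [h|[p np|q _]]; [|by case: np|by []].
by case: (pselect (P e)) => p; [left | right; exact: h].
Qed.

Lemma dpred_and (I : Type) (P Q : (I -> N) -> Prop) :
  dpred P -> dpred Q -> dpred (fun e => P e /\ Q e).
Proof.
move=> dP dQ.
apply: dpred_ext (dpred_not (dpred_or (dpred_not dP) (dpred_not dQ))) => e.
split=> [h|[p q] []//].
by split; apply: contrapT => h'; apply: h; [left | right].
Qed.

Lemma dpred_eq (I : Type) (v w : I) : dpred (fun e : I -> N => e v = e w).
Proof.
exists 2%N, (Equal (Var L (@ord0 1)) (Var L ord_max)).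
exists (fun i : 'I_2 => if i == ord0 then inl v else inl w) => e /=.
by rewrite !tnth_mktuple /=.
Qed.

Lemma dpred_forall_fin (I : Type) (k : nat) (P : 'I_k -> (I -> N) -> Prop) :
  (forall i, dpred (P i)) -> dpred (fun e => forall i, P i e).
Proof.
elim: k P => [|k IH] P dP; first by apply: dpred_ext (dpred_True I) => e; split=> // _ [].
have h := dpred_and (dP ord0) (IH _ (fun i => dP (lift ord0 i))).
apply: dpred_ext h => e; split=> [[h0 h1] i|h]; last by split.
by case: (unliftP ord0 i) => [j|] ->.
Qed.

(** Several variables of the formula may stand for the quantified variable [None]; [r] merges them
    all into variable 0. *)
Lemma dpred_all (I : Type) (P : N -> (I -> N) -> Prop) :
  dpred (fun e : option I -> N => P (e None) (fun i => e (Some i))) ->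
  dpred (fun e => forall x, P x e).
Proof.
case=> K [phi [s H]].
pose r (i : 'I_K) : 'I_K.+1 := if s i is inl None then ord0 else lift ord0 i.
(* [r] no longer reads the positions that stood for the bound variable; [a0] fills them. *)
have [a0] := carrier_nonempty N.
pose t (i : 'I_K) : I + N :=
  match s i with inl (Some v) => inl v | inl None => inr a0 | inr a => inr a end.
exists K, (All (renf phi r)), t => e /=.
have E x : [tuple tnth (cons_tuple x
      [tuple valuation e (t i) | i < K]) (r i) | i < K] =
    [tuple valuation (oapp e x) (s i) | i < K].
  apply: eq_from_tnth => i; rewrite !tnth_mktuple /r /t.
  by case si: (s i) => [[v|]|a]; rewrite ?tnth0 // tnthS tnth_mktuple si.
by split=> h x; move: (h x); rewrite sat_renf E -(H (oapp e x)).
Qed.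

Lemma dpred_all_tuple (I : Type) (k : nat) (P : ('I_k -> N) -> (I -> N) -> Prop) :
  dpred (fun e : 'I_k + I -> N => P (e \o inl) (e \o inr)) ->
  dpred (fun e => forall t, P t e).
Proof.
elim: k I P => [|k IH] I P dP.
  have [a0] := carrier_nonempty N.
  have h := dpred_subst (fun v : 'I_0 + I =>
    match v with inl _ => inr a0 | inr i => inl i end : I + N) dP.
  apply: dpred_ext h => e /=; rewrite /comp /=.
  split=> [h t|]; last exact.
  by rewrite (_ : t = fun=> a0) //; apply: funext => -[].
pose glue (x : N) (t : 'I_k -> N) (i : 'I_k.+1) := oapp t x (unlift ord0 i).
have dQ : dpred (fun e => forall x (t : 'I_k -> N), P (glue x t) e).
  apply: dpred_all; apply: (IH _ (fun t e =>
    P (glue (e None) t) (fun i => e (Some i)))).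
  pose s (v : 'I_k.+1 + I) : ('I_k + option I) :=
    match v with inl i => oapp inl (inr None) (unlift ord0 i)
               | inr i => inr (Some i) end.
  apply: dpred_ext (dpred_ren s dP) => e.
  rewrite (_ : (e \o s) \o inl = glue ((e \o inr) None) (e \o inl)) //.
  by apply: funext => i; rewrite /glue /s /=; case: (unlift ord0 i).
apply: dpred_ext dQ => e; split=> [h t|h x t]; last exact: h.
rewrite (_ : t = glue (t ord0) (fun i => t (lift ord0 i))) //.
by apply: funext => i; rewrite /glue; case: unliftP => [j|] ->.
Qed.

Lemma definable_dpred (n : nat) (A : set (n.-tuple N)) :
  definable A <-> dpred (fun e : 'I_n -> N => A [tuple e i | i < n]).
Proof.
split=> [[m [phi [a ->]]]|[K [phi [s H]]]].
  exists (n + m)%N, phi.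
  exists (fun i => match fintype.split i with inl j => inl j | inr k => inr (tnth a k) end).
  move=> e; rewrite /def_set /=.
  rewrite (_ : cat_tuple _ _ = [tuple valuation e
    match fintype.split i with inl j => inl j | inr k => inr (tnth a k) end | i < n + m]) //.
  apply: eq_from_tnth => i; rewrite tnth_mktuple.
  rewrite -[in LHS](splitK i); case: (fintype.split i) => j /=.
    by rewrite tnth_lshift tnth_mktuple.
  by rewrite tnth_rshift.
(* The parameters are put into one tuple of length [K], with [a0] at the positions occupied by
   variables. *)
have [a0] := carrier_nonempty N.
pose r (i : 'I_K) : 'I_(n + K) :=
  match s i with inl j => lshift K j | inr _ => rshift n i end.
exists K, (renf phi r), [tuple valuation (fun=> a0) (s i) | i < K].
apply: funext => x; apply: propext; rewrite /def_set /=.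
have -> : A x <-> A [tuple tnth x i | i < n].
  by rewrite (_ : mktuple _ = x) //; apply: eq_from_tnth => i; rewrite tnth_mktuple.
rewrite (H (tnth x)) sat_renf.
rewrite (_ : [tuple _ | i < K] = [tuple tnth (cat_tuple x
    [tuple valuation (fun=> a0) (s i) | i < K]) (r i) | i < K]) //.
apply: eq_from_tnth => i; rewrite !tnth_mktuple /r.
case si: (s i) => [j|a]; first by rewrite tnth_lshift.
by rewrite tnth_rshift tnth_mktuple si.
Qed.

End DefinablePredicates.
(** * Ultrapowers *)

Section UltrafilterLogic.
Variables (T : Type) (U : set_system T) (UU : UltraFilter U).

(** The converse is where maximality of [U] enters: the premise or its complement is in [U]. *)
Lemma ultra_imp (P Q : T -> Prop) :
  U [set i | P i -> Q i] <-> (U [set i | P i] -> U [set i | Q i]).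
Proof.
split=> [h hP|h]; first by apply: filterS2 hP h => i Pi; exact.
have [/h|] := in_ultra_setVsetC [set i | P i] UU; apply: filterS => i.
  by move=> Qi _.
by move=> nP /nP.
Qed.

(** For the converse, take for [f i] a counterexample at [i] whenever one exists. *)
Lemma ultra_forall (X : Type) (P : X -> T -> Prop) :
  inhabited X ->
  U [set i | forall x, P x i] <-> forall f : T -> X, U [set i | P (f i) i].
Proof.
move=> [x0]; split=> [h f|h]; first by apply: filterS h => i; exact.
have /choice [f fP] : forall i, exists x, P x i -> forall y, P y i.
  move=> i; have [[x nPx]|nP] := pselect (exists x, ~ P x i); first by exists x => /nPx.
  by exists x0 => _ x; apply: contrapT => nPx; apply: nP; exists x.
by apply: filterS (h f) => i; exact: fP.
Qed.

Lemma ultra_exists (X : Type) (P : X -> T -> Prop) :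
  inhabited X ->
  U [set i | exists x, P x i] -> exists f : T -> X, U [set i | P (f i) i].
Proof.
move=> [x0] h.
have /choice [f fP] : forall i, exists x, (exists y, P y i) -> P x i.
  move=> i; have [[y Py]|n] := pselect (exists y, P y i); first by exists y.
  by exists x0 => /n.
by exists f; apply: filterS h => i; exact: fP.
Qed.

Lemma ultra_ord (k : nat) (P : 'I_k -> T -> Prop) :
  (forall j, U [set i | P j i]) -> U [set i | forall j, P j i].
Proof. exact: filter_forall. Qed.

End UltrafilterLogic.

Lemma nonprincipal_ultrafilter :
  exists U : set_system nat, UltraFilter U /\ forall k, U [set i | (k <= i)%N].
Proof.
have [U [UU sU]] := ultraFilterLemma eventually_filter.
by exists U; split=> // k; apply: sU; exists k.
Qed.

Section Ultrapower.
Variables (L : language) (M : structure L).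
Variables (U : set_system nat) (UU : UltraFilter U).

Definition ultra_class (f : nat -> M) : set (nat -> M) :=
  [set f' | U [set i | f i = f' i]].

Definition ultra_carrier := {A : set (nat -> M) | exists f, A = ultra_class f}.

Definition cls (f : nat -> M) : ultra_carrier :=
  exist _ (ultra_class f) (ex_intro _ f erefl).

Definition rep (a : ultra_carrier) : nat -> M := projT1 (cid (projT2 a)).

Lemma rep_cls f : U [set i | rep (cls f) i = f i].
Proof.
rewrite /rep; case: cid => f' /= E.
suff : ultra_class f' f by [].
by rewrite -E; apply: filterE.
Qed.

Lemma cls_rep a : cls (rep a) = a.
Proof.
case: a => A hA; apply: eq_exist.
by rewrite /rep; case: cid => f /= ->.
Qed.

Lemma cls_eq f f' : cls f = cls f' <-> U [set i | f i = f' i].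
Proof.
split=> [E|E].
  have h := rep_cls f; have h' := rep_cls f'; rewrite -E in h'.
  by apply: filterS2 h h' => i /= -> ->.
apply: eq_exist; apply/seteqP; split=> g h; apply: filterS2 E h => i /= -> //.
Qed.

Lemma rep_eq a b : a = b <-> U [set i | rep a i = rep b i].
Proof. by rewrite -cls_eq !cls_rep. Qed.

Definition ultrapower : structure L := {|
  carrier := ultra_carrier;
  carrier_nonempty :=
    let: inhabits a := carrier_nonempty M in inhabits (cls (fun=> a));
  func_interp := fun f t =>
    cls (fun i => func_interp [tuple rep (tnth t j) i | j < func_arity f]);
  pred_interp := fun r t =>
    U [set i | pred_interp [tuple rep (tnth t j) i | j < pred_arity r]] |}.

Definition component (k : nat) (e : k.-tuple ultrapower) (i : nat) :
  k.-tuple M := [tuple rep (tnth e j) i | j < k].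

Lemma ultra_eval (k : nat) (t : term L k) (e : k.-tuple ultrapower) :
  U [set i | rep (eval e t) i = eval (component e i) t].
Proof.
elim: t => [j|f ts IH] /=.
  by apply: filterE => i; rewrite /= /component tnth_mktuple.
have h1 := ultra_ord UU IH.
have h2 := rep_cls (fun i => func_interp
  [tuple rep (tnth [tuple eval e (ts j) | j < func_arity f] j) i | j < func_arity f]).
apply: filterS2 h2 h1 => i /= -> IHi.
by congr func_interp; apply: eq_from_tnth => j; rewrite !tnth_mktuple IHi.
Qed.

(** Induction on the formula: implication rests on the maximality of [U], and the quantifier on the
    choice of counterexamples in [ultra_forall]. *)
Theorem Los (k : nat) (phi : formula L k) (e : k.-tuple ultrapower) :
  sat phi e <-> U [set i | sat phi (component e i)].
Proof.
elim: phi e => {k} [k|k t u|k r ts|k p IHp q IHq|k p IHp] e /=.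
- by split=> // /filter_ex[].
- rewrite rep_eq; split; apply: filterS3 (ultra_eval t e) (ultra_eval u e) => i;
    by move=> /= -> ->.
- have h := ultra_ord UU (fun j => ultra_eval (ts j) e).
  have E i : (forall j, rep (eval e (ts j)) i = eval (component e i) (ts j)) ->
      [tuple rep (tnth [tuple eval e (ts j) | j < pred_arity r] j) i | j < pred_arity r] =
      [tuple eval (component e i) (ts j) | j < pred_arity r].
    by move=> hi; apply: eq_from_tnth => j; rewrite !tnth_mktuple hi.
  by split; apply: filterS2 h => i /= /E ->.
- by rewrite ultra_imp IHp IHq.
- rewrite ultra_forall; last exact: carrier_nonempty.
  have E x i : component (cons_tuple x e) i = cons_tuple (rep x i) (component e i).
    apply: eq_from_tnth => j; rewrite tnth_mktuple.
    by case: (unliftP ord0 j) => [j'|] ->; rewrite ?tnth0 // !tnthS tnth_mktuple.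
  split=> [h f|h x]; last first.
    by rewrite IHp; apply: filterS (h (rep x)) => i; rewrite /= E.
  have /IHp := h (cls f).
  by apply: filterS2 (rep_cls f) => i /= fi; rewrite E fi.
Qed.

Definition diag (k : nat) (a : k.-tuple M) : k.-tuple ultrapower :=
  [tuple cls (fun=> tnth a j) | j < k].

Lemma component_diag (k : nat) (a : k.-tuple M) :
  U [set i | component (diag a) i = a].
Proof.
apply: filterS (ultra_ord UU (fun j => rep_cls (fun=> tnth a j))) => i h.
by apply: eq_from_tnth => j; rewrite !tnth_mktuple h.
Qed.

(** The diagonal embedding is elementary, by [Los]; this lets [dim_invariant] compare dimensions in
    the structure and in its ultrapower. *)
Lemma same_type_diag (k : nat) (a : k.-tuple M) : same_type a (diag a).
Proof.
move=> phi; rewrite Los; split=> h.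
  by apply: filterS (component_diag a) => i /= ->.
have : U [set _ | sat phi a] by apply: filterS2 h (component_diag a) => i /= + <-.
by case/filter_ex.
Qed.

Lemma ultrapower_model (T : theory L) : is_model T M -> is_model T ultrapower.
Proof.
move=> TM phi Tphi; rewrite Los; apply: filterE => i /=.
by rewrite (_ : component _ i = [tuple]) //; [exact: TM | exact: tuple0].
Qed.

(* [A] is not required to be definable. *)
Definition star_set (k : nat) (A : set (k.-tuple M)) : set (k.-tuple ultrapower) :=
  [set x | U [set i | A (component x i)]].

Lemma star_def_set (k m : nat) (phi : formula L (k + m)) (a : m.-tuple M) :
  star_set (def_set phi a) = def_set phi (diag a).
Proof.
have E x i : component (cat_tuple x (diag a)) i =
    cat_tuple (component x i) (component (diag a) i).
  apply: eq_from_tnth => j; rewrite tnth_mktuple.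
  rewrite -(splitK j); case: (fintype.split j) => j' /=.
    by rewrite !tnth_lshift tnth_mktuple.
  by rewrite !tnth_rshift !tnth_mktuple.
apply/seteqP; split=> x; rewrite /def_set /star_set /= Los;
  by apply: filterS2 (component_diag a) => i /= h; rewrite E h.
Qed.

(** The parameters of the formula become classes of constant sequences, and [Los] applies. *)
Lemma dpred_star (I : Type) (P : (I -> M) -> Prop) :
  dpred P ->
  dpred (fun e : I -> ultrapower => U [set i | P (fun v => rep (e v) i)]).
Proof.
case=> K [phi [s H]].
exists K, phi, (fun j => match s j with inl v => inl v | inr a => inr (cls (fun=> a)) end).
move=> e; rewrite Los.
have h : U [set i | component [tuple valuation e (match s j with inl v => inl v
    | inr a => inr (cls (fun=> a)) end) | j < K] i =
    [tuple valuation (fun v => rep (e v) i) (s j) | j < K]].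
  suff /(ultra_ord UU) : forall j : 'I_K, U [set i | rep (valuation e (match s j with
      inl v => inl v | inr a => inr (cls (fun=> a)) end)) i =
      valuation (fun v => rep (e v) i) (s j)].
    by apply: filterS => i hi; apply: eq_from_tnth => j; rewrite !tnth_mktuple hi.
  by move=> j; case: (s j) => [v|a] /=; [exact: filterE | exact: rep_cls].
by split; apply: filterS2 h => i /= ->; rewrite H.
Qed.

End Ultrapower.
(** * Dimension of definable sets *)

Section TupleRelations.
Variables (T : Type) (n p : nat).

Definition lpart (w : (n + p).-tuple T) : n.-tuple T :=
  [tuple tnth w (lshift p j) | j < n].
Definition rpart (w : (n + p).-tuple T) : p.-tuple T :=
  [tuple tnth w (rshift n j) | j < p].

Lemma lpart_cat u v : lpart (cat_tuple u v) = u.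
Proof. by apply: eq_from_tnth => j; rewrite tnth_mktuple tnth_lshift. Qed.

Lemma rpart_cat u v : rpart (cat_tuple u v) = v.
Proof. by apply: eq_from_tnth => j; rewrite tnth_mktuple tnth_rshift. Qed.

Lemma cat_parts w : cat_tuple (lpart w) (rpart w) = w.
Proof.
apply: eq_from_tnth => i; rewrite -(splitK i); case: (fintype.split i) => j /=.
  by rewrite tnth_lshift tnth_mktuple.
by rewrite tnth_rshift tnth_mktuple.
Qed.

Definition graph_of (R : n.-tuple T -> p.-tuple T -> Prop) : set ((n + p).-tuple T) :=
  [set w | R (lpart w) (rpart w)].

Lemma graph_of_cat R u v : graph_of R (cat_tuple u v) = R u v.
Proof. by rewrite /graph_of /= lpart_cat rpart_cat. Qed.

End TupleRelations.

Lemma mktuple_tnth (T : Type) (n : nat) (x : n.-tuple T) : [tuple tnth x i | i < n] = x.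
Proof. by apply: eq_from_tnth => i; rewrite tnth_mktuple. Qed.

(** The copy of a definable set among the interpretable sets, whose elements are classes. *)
Definition singletons (X : Type) (A : set X) : set (set X) := [set [set x] | x in A].

(** * Definable relations and interpretable sets *)

Section Definability.
Variables (L : language) (N : structure L).

Lemma definable_graph_of (n p : nat) (R : n.-tuple N -> p.-tuple N -> Prop) :
  dpred (fun e : 'I_n + 'I_p -> N =>
    R [tuple e (inl i) | i < n] [tuple e (inr i) | i < p]) <->
  definable (graph_of R).
Proof.
rewrite definable_dpred; split=> dR.
  pose s (v : 'I_n + 'I_p) := match v with inl i => lshift p i | inr i => rshift n i end.
  apply: dpred_ext (dpred_ren s dR) => e; rewrite /graph_of /= /lpart /rpart /comp /=.
  set a := mktuple _; set b := mktuple _; set a' := mktuple _; set b' := mktuple _.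
  have -> : a' = a by apply: eq_from_tnth => i; rewrite !tnth_mktuple.
  by have -> : b' = b by apply: eq_from_tnth => i; rewrite !tnth_mktuple.
apply: dpred_ext (dpred_ren (@fintype.split n p) dR) => e.
rewrite /graph_of /=.
rewrite (_ : lpart _ = [tuple e (inl i) | i < n]); last first.
  by apply: eq_from_tnth => i; rewrite !tnth_mktuple /= (unsplitK (inl _ i)).
rewrite (_ : rpart _ = [tuple e (inr i) | i < p]) //.
by apply: eq_from_tnth => i; rewrite !tnth_mktuple /= (unsplitK (inr _ i)).
Qed.

Lemma definable_setI (n : nat) (A B : set (n.-tuple N)) :
  definable A -> definable B -> definable (A `&` B).
Proof. by rewrite !definable_dpred; exact: dpred_and. Qed.

Lemma definable_setU (n : nat) (A B : set (n.-tuple N)) :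
  definable A -> definable B -> definable (A `|` B).
Proof. by rewrite !definable_dpred; exact: dpred_or. Qed.

Lemma definable_slice (n p : nat) (R : n.-tuple N -> p.-tuple N -> Prop) (v : p.-tuple N) :
  definable (graph_of R) -> definable [set u | R u v].
Proof.
rewrite -definable_graph_of definable_dpred => dR.
have := dpred_subst (fun w : 'I_n + 'I_p =>
  match w with inl i => inl i | inr i => inr (tnth v i) end : 'I_n + N) dR.
by apply: dpred_ext => e /=; rewrite mktuple_tnth.
Qed.

Lemma definable_graph_and (n p : nat) (R S : n.-tuple N -> p.-tuple N -> Prop) :
  definable (graph_of R) -> definable (graph_of S) ->
  definable (graph_of (fun u v => R u v /\ S u v)).
Proof. by rewrite -!definable_graph_of; exact: dpred_and. Qed.

Lemma definable_graph_l (n p : nat) (A : set (n.-tuple N)) :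
  definable A -> definable (graph_of (fun u (_ : p.-tuple N) => A u)).
Proof. rewrite -definable_graph_of definable_dpred; exact: (dpred_ren (@inl 'I_n 'I_p)). Qed.

Lemma definable_graph_r (n p : nat) (B : set (p.-tuple N)) :
  definable B -> definable (graph_of (fun (_ : n.-tuple N) v => B v)).
Proof. rewrite -definable_graph_of definable_dpred; exact: (dpred_ren (@inr 'I_n 'I_p)). Qed.

Lemma definable_graph_eq (n : nat) :
  definable (graph_of (fun u v : n.-tuple N => u = v)).
Proof.
rewrite -definable_graph_of.
apply: dpred_ext (dpred_forall_fin (fun i : 'I_n => dpred_eq N (inl i) (inr i))) => e.
split=> [h|h i]; first by apply: eq_from_tnth => i; rewrite !tnth_mktuple h.
by have := congr1 (fun t => tnth t i) h; rewrite !tnth_mktuple.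
Qed.

Lemma definable_set1 (n : nat) (a : n.-tuple N) : definable [set a].
Proof. exact: definable_slice (definable_graph_eq n). Qed.

Lemma def_set_pad (n m m' : nat) (phi : formula L (n + m)) (s : 'I_m -> 'I_m')
    (a : m'.-tuple N) :
  exists psi : formula L (n + m'),
    def_set phi [tuple tnth a (s i) | i < m] = def_set psi a.
Proof.
pose r (i : 'I_(n + m)) : 'I_(n + m') :=
  match fintype.split i with inl j => lshift m' j | inr j => rshift n (s j) end.
exists (renf phi r); apply: funext => x; apply: propext; rewrite /def_set /= sat_renf.
rewrite (_ : cat_tuple _ _ = [tuple tnth (cat_tuple x a) (r i) | i < n + m]) //.
apply: eq_from_tnth => i; rewrite tnth_mktuple /r -[in LHS](splitK i).
case: (fintype.split i) => j /=; rewrite ?tnth_lshift // !tnth_rshift.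
by rewrite tnth_mktuple.
Qed.

(** [interpretable] asks for one parameter tuple for both the set and the equivalence relation;
    concatenation provides it. *)
Lemma common_params (n p : nat) (A : set (n.-tuple N)) (B : set (p.-tuple N)) :
  definable A -> definable B ->
  exists (m : nat) (phi : formula L (n + m)) (psi : formula L (p + m))
    (a : m.-tuple N), A = def_set phi a /\ B = def_set psi a.
Proof.
move=> [m [phi [a ->]]] [m' [psi [b ->]]].
have [phi' E] := def_set_pad phi (@lshift m m') (cat_tuple a b).
have [psi' E'] := def_set_pad psi (@rshift m m') (cat_tuple a b).
exists (m + m')%N, phi', psi', (cat_tuple a b); rewrite -E -E'.
by rewrite -/(lpart _) -/(rpart _) lpart_cat rpart_cat.
Qed.

Lemma interpretable_quotient (n : nat) (D : set (n.-tuple N))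
    (R : n.-tuple N -> n.-tuple N -> Prop) :
  definable D -> definable (graph_of R) -> equivalence_on D R ->
  interpretable (quotient_set D R).
Proof.
move=> dD dR RE; have [m [delta [eps [a [ED ER]]]]] := common_params dD dR.
exists m, delta, eps, a; rewrite -ED.
suff -> : def_rel eps a = R by [].
by apply: funext => x; apply: funext => y; rewrite /def_rel -ER graph_of_cat.
Qed.

Lemma singletons_quotient (X : Type) (A : set X) : singletons A = quotient_set A eq.
Proof.
apply: eq_imagel => x Ax; apply/seteqP.
by split=> [_ ->|y [_ ->]].
Qed.

Lemma equivalence_eq (X : Type) (A : set X) : equivalence_on A eq.
Proof. by split=> // x y z *; etransitivity; eauto. Qed.

Lemma interpretable_singletons (n : nat) (A : set (n.-tuple N)) :
  definable A -> interpretable (singletons A).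
Proof.
move=> dA; rewrite singletons_quotient.
by apply: interpretable_quotient => //; [exact: definable_graph_eq|exact: equivalence_eq].
Qed.

End Definability.

Lemma dim_le_refl d : dim_le d d.
Proof. by case: d => /=. Qed.

Lemma dim_le_trans d e f : dim_le d e -> dim_le e f -> dim_le d f.
Proof. by case: d e f => [i|] [j|] [k|] //=; exact: leq_trans. Qed.

Lemma dim_le_maxl d e : dim_le d (dim_max d e).
Proof. by rewrite /dim_max; case: ifP => // _; exact: dim_le_refl. Qed.

Lemma singletonsU (X : Type) (A B : set X) :
  singletons (A `|` B) = singletons A `|` singletons B.
Proof. exact: image_setU. Qed.

(** * Dimension under unions, surjections and quotients *)

Section Dimension.
Variables (L : language) (T : theory L).
Variable dim : forall (M : structure L) (n : nat), set (set (n.-tuple M)) -> dimension.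
Hypothesis dimP : is_dimension T dim.
Variables (N : structure L) (NT : is_model T N).

Definition ddim (n : nat) (A : set (n.-tuple N)) : dimension := dim (singletons A).

Lemma ddimU (n : nat) (A B : set (n.-tuple N)) :
  definable A -> definable B -> ddim (A `|` B) = dim_max (ddim A) (ddim B).
Proof.
move=> dA dB; have dU := interpretable_singletons (definable_setU dA dB).
rewrite /ddim singletonsU in dU *.
by rewrite (dim_union dimP) //; exact: interpretable_singletons.
Qed.

Lemma ddim_mono (n : nat) (A B : set (n.-tuple N)) :
  definable A -> definable B -> A `<=` B -> dim_le (ddim A) (ddim B).
Proof. by move=> dA dB /setUidr <-; rewrite ddimU //; exact: dim_le_maxl. Qed.

Lemma ddim_set1 (n : nat) (a : n.-tuple N) : ddim [set a] = Some 0%N.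
Proof.
apply/(dim_zero dimP) => //.
  exact/interpretable_singletons/definable_set1.
by rewrite /singletons image_set1; split; [exact: finite_set1 | exists [set a]].
Qed.

Lemma ddim_nonempty (n : nat) (A : set (n.-tuple N)) :
  definable A -> A !=set0 -> exists k, ddim A = Some k.
Proof.
move=> dA [a Aa]; have := ddim_mono (definable_set1 a) dA.
rewrite ddim_set1; case: (ddim A) => [k _|h]; first by exists k.
by have /h : [set a] `<=` A by move=> _ ->.
Qed.

(** The fibres of a surjection are nonempty, so of dimension at least 0, and [dim_fibre_ge] applies
    with bound 0. On singletons, [F] acts through direct images. *)
Lemma ddim_image (n p : nat) (A : set (n.-tuple N)) (B : set (p.-tuple N))
    (F : n.-tuple N -> p.-tuple N) :
  definable A -> definable B ->
  definable (graph_of (fun u v => A u /\ F u = v)) ->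
  (forall u, A u -> B (F u)) -> (forall v, B v -> exists2 u, A u & F u = v) ->
  dim_le (ddim B) (ddim A).
Proof.
move=> dA dB dF AB BA.
suff : dim_le (dim_add (ddim B) 0) (ddim A).
  by case: (ddim B) => //= k; rewrite addn0.
have f1 u : F @` [set u] = [set F u] by exact: image_set1.
apply: (@dim_fibre_ge _ _ _ dimP _ _ _ _ _ (fun S => F @` S)) => //.
- exact: interpretable_singletons.
- exact: interpretable_singletons.
- split=> [_ [u Au <-]|]; first by rewrite f1; exists (F u) => //; exact: AB.
  apply: (eq_ind _ (fun S => definable S) dF); apply/seteqP; split.
    move=> w [Aw Fw]; exists [set lpart w]; first by exists (lpart w).
    exists (lpart w) => //; exists (rpart w); last exact: cat_parts.
    by rewrite f1 Fw.
  move=> w [S [u Au <-] [u' -> [v]]]; rewrite f1 => -> <-.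
  by rewrite /graph_of /= lpart_cat rpart_cat.
- move=> _ [v Bv <-].
  have -> : singletons A `&` (fun S => F @` S) @^-1` [set [set v]] =
      singletons [set u | A u /\ F u = v].
    apply/seteqP; split=> [_ [[u Au <-]]|_ [u [Au Fu] <-]]; last first.
      by split; [exists u | rewrite /= f1 Fu].
    rewrite /= f1 => h; exists u => //; split=> //.
    by have : [set v] (F u) by rewrite -h.
  have dfib := definable_slice v dF.
  have [|k] := ddim_nonempty dfib; last by rewrite /ddim => ->.
  by have [u Au Fu] := BA _ Bv; exists u.
Qed.

(** Send each point to its class. The quotient, being infinite and not of dimension -oo, has
    dimension at least 1, and the fibres contribute [k]. *)
Lemma ddim_quotient_infinite (n k : nat) (D : set (n.-tuple N))
    (E : n.-tuple N -> n.-tuple N -> Prop) :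
  definable D -> definable (graph_of E) -> equivalence_on D E ->
  D !=set0 -> ~ finite_set (quotient_set D E) ->
  (forall u, D u -> dim_le (Some k) (ddim [set v | D v /\ E u v])) ->
  dim_le (Some k.+1) (ddim D).
Proof.
move=> dD dE EE D0 infD hk.
have [Er Es Et] := EE.
pose f (S : set (n.-tuple N)) := [set v | D v /\ exists2 u, S u & E u v].
have f1 u : f [set u] = [set v | D v /\ E u v].
  apply/seteqP; split=> v /= [Dv]; first by case=> _ ->.
  by move=> Euv; split=> //; exists u.
have iQ := interpretable_quotient dD dE EE.
have iD := interpretable_singletons dD.
have fI : interpretable_fun (singletons D) (quotient_set D E) f.
  split=> [_ [u Du <-]|]; first by rewrite f1; exists u.
  have dG := definable_graph_and (definable_graph_l n dD)
    (definable_graph_and (definable_graph_r n dD) dE).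
  apply: (eq_ind _ (fun S => definable S) dG); apply/seteqP; split.
    move=> w [Dw [Dw' Ew]]; exists [set lpart w]; first by exists (lpart w).
    exists (lpart w) => //; exists (rpart w); last exact: cat_parts.
    by rewrite f1.
  move=> w [S [u Du <-] [u' -> [v]]]; rewrite f1 => -[Dv Euv] <-.
  by rewrite /graph_of /= lpart_cat rpart_cat.
have fib B : quotient_set D E B -> exists u, [/\ D u, B = [set v | D v /\ E u v] &
    singletons D `&` f @^-1` [set B] = singletons [set v | D v /\ E u v]].
  case=> u Du <-; exists u; split=> //.
  apply/seteqP; split=> [_ [[v Dv <-]]|_ [v [Dv Euv] <-]]; rewrite /=.
    rewrite f1 => /(congr1 (fun S => S v)) /= h; exists v => //; split=> //.
    by have [] : D v /\ E u v by rewrite -h; split=> //; exact: Er.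
  split; first by exists v.
  rewrite f1; apply/seteqP; split=> w /= [Dw Ew]; split=> //.
    exact: Et Euv Ew.
  by apply: Et Ew => //; exact: Es.
have dfib u : definable [set v | D v /\ E u v].
  apply: definable_setI => //.
  have := dE; rewrite -definable_graph_of definable_dpred => dE'.
  have := dpred_subst (fun w : 'I_n + 'I_n =>
    match w with inl i => inr (tnth u i) | inr i => inl i end : 'I_n + N) dE'.
  by apply: dpred_ext => e /=; rewrite mktuple_tnth.
have [d Dd] := ddim_nonempty dD D0.
have hge : dim_le (dim_add (dim (quotient_set D E)) k) (ddim D).
  apply: (@dim_fibre_ge _ _ _ dimP _ _ _ _ _ f) => // B /fib[u [Du _ ->]].
  exact: hk.
(* This excludes -oo as the dimension of the quotient. *)
have hle : dim_le (ddim D) (dim_add (dim (quotient_set D E)) d).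
  apply: (@dim_fibre_le _ _ _ dimP _ _ _ _ _ f) => // B /fib[u [Du _ ->]].
  by rewrite -Dd; apply: ddim_mono => // v [].
have Q0 : quotient_set D E !=set0.
  by case: D0 => u Du; exists [set v | D v /\ E u v]; exists u.
have := dim_zero dimP NT iQ.
case: (dim (quotient_set D E)) hge hle => [[|q]|]; rewrite Dd //=.
  by move=> _ _ [h _]; case: infD; case: h.
by move=> h _ _; apply: leq_trans h; rewrite addSn ltnS leq_addl.
Qed.

End Dimension.

(** The two sets come from one formula at parameters of the same type, so [dim_invariant] applies
    once the formula [eps] for equality is known to define equality in the ultrapower too. *)
Lemma ddim_star (L : language) (T : theory L)
    (dim : forall (M : structure L) (n : nat), set (set (n.-tuple M)) -> dimension)
    (dimP : is_dimension T dim) (M : structure L) (MT : is_model T M)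
    (U : set_system nat) (UU : UltraFilter U) (n : nat) (A : set (n.-tuple M)) :
  definable A ->
  ddim dim (star_set (U := U) A) = ddim dim A.
Proof.
move=> dA; have [m [phi [eps [a [-> EE]]]]] := common_params dA (definable_graph_eq M n).
rewrite star_def_set.
have ME : def_rel eps a = eq.
  by apply: funext => x; apply: funext => y; rewrite /def_rel -EE graph_of_cat.
have SE : def_rel eps (diag U a) = eq.
  apply: funext => x; apply: funext => y; rewrite /def_rel -star_def_set // -EE.
  apply: propext; rewrite /star_set /=; split=> [h|->]; last first.
    apply: filterE => i; rewrite /graph_of /=.
    by apply: eq_from_tnth => j; rewrite !tnth_mktuple tnth_lshift tnth_rshift.
  apply: eq_from_tnth => j; apply/rep_eq; apply: filterS h => i.
  move=> /(congr1 (fun t => tnth t j)).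
  by rewrite /= !tnth_mktuple tnth_lshift tnth_rshift.
rewrite /ddim !singletons_quotient -{1}SE -ME.
apply: esym; apply: (dim_invariant dimP) => //.
- exact: ultrapower_model.
- exact: same_type_diag.
- by rewrite ME; exact: equivalence_eq.
- by rewrite SE; exact: equivalence_eq.
Qed.
(** * Finite index *)

(* At most [k] cosets of [B] meet [f @` D].  Neither [D] nor [f @` D] has to be
   a subgroup. *)
Definition few (h : zmodType) (X : Type) (D : set X) (f : X -> h) (B : set h)
    (k : nat) : Prop :=
  exists col : X -> 'I_k,
    forall x y, D x -> D y -> col x = col y -> B (f x - f y).

Definition fin (h : zmodType) (X : Type) (D : set X) (f : X -> h) (B : set h) : Prop :=
  exists k, few D f B k.

Section FiniteIndex.
Variable h : zmodType.
Implicit Types A B C : set h.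

Section Subgroup.
Variables (A : set h) (sA : additive_subgroup A).

Lemma subg0 : A 0. Proof. by case: sA. Qed.
Lemma subgB x y : A x -> A y -> A (x - y). Proof. by case: sA => _; exact. Qed.
Lemma subgN x : A x -> A (- x).
Proof. by rewrite -[- x]add0r; apply: subgB; exact: subg0. Qed.
Lemma subgD x y : A x -> A y -> A (x + y).
Proof. by move=> Ax Ay; rewrite -[y]opprK; apply: subgB => //; exact: subgN. Qed.
Lemma subgBC x y : A (x - y) -> A (y - x).
Proof. by move=> /subgN; rewrite opprB. Qed.
Lemma subgBK x y : A y -> A (x - y) -> A x.
Proof. by move=> Ay /subgD/(_ Ay); rewrite subrK. Qed.
Lemma subgBt y x z : A (x - y) -> A (y - z) -> A (x - z).
Proof. by move=> Axy /(subgD Axy); rewrite subrKA. Qed.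
Lemma subg_sum (s : seq h) : (forall x, x \in s -> A x) -> A (\sum_(x <- s) x).
Proof. by move=> sP; rewrite big_seq; apply: big_ind => //; [exact: subg0|exact: subgD]. Qed.
End Subgroup.

Lemma subgI A B : additive_subgroup A -> additive_subgroup B -> additive_subgroup (A `&` B).
Proof.
move=> sA sB; split=> [|x y [Ax Bx] [Ay By]]; first by split; exact: subg0.
by split; exact: subgB.
Qed.

Lemma few_fintype (X : Type) (Y : finType) (D : set X) (f : X -> h) B (col : X -> Y) (k : nat) :
  (#|Y| <= k)%N ->
  (forall x y, D x -> D y -> col x = col y -> B (f x - f y)) -> few D f B k.
Proof.
move=> Yk H; exists (fun x => widen_ord Yk (enum_rank (col x))) => x y Dx Dy E.
apply: H => //; apply: enum_rank_inj; apply: val_inj; exact: (congr1 val E).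
Qed.

Lemma few_le (X : Type) (D : set X) (f : X -> h) B k k' :
  (k <= k')%N -> few D f B k -> few D f B k'.
Proof. by move=> kk' [col H]; apply: (few_fintype (col := col)) => //; rewrite card_ord. Qed.

Lemma few_map (X Y : Type) (D : set X) (f : X -> h) (D' : set Y) (f' : Y -> h)
    (m : Y -> X) B B' k :
  (forall y, D' y -> D (m y)) ->
  (forall y z, D' y -> D' z -> B (f (m y) - f (m z)) -> B' (f' y - f' z)) ->
  few D f B k -> few D' f' B' k.
Proof.
move=> mD BB' [col H]; exists (col \o m) => y z /[dup]/mD? ? /[dup]/mD? ? /H.
by auto.
Qed.

Lemma few_setI (X : Type) (D : set X) (f : X -> h) B C k k' :
  few D f B k -> few D f C k' -> few D f (B `&` C) (k * k').
Proof.
move=> [c1 H1] [c2 H2]; apply: (few_fintype (col := fun x => (c1 x, c2 x))).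
  by rewrite card_prod !card_ord.
by move=> x y Dx Dy [E1 E2]; split; auto.
Qed.

(** [r] picks an element of [A] in each colour class of [c1]. Colour [x] by its class and by the
    [c2]-colour of [x - r (c1 x)], which lies in both [A] and [B]. *)
Lemma few_trans A B C k k' :
  additive_subgroup A ->
  few A id B k -> few (A `&` B) id C k' -> few A id C (k * k').
Proof.
move=> sA [c1 H1] [c2 H2].
have /choice [r rP] : forall i : 'I_k, exists r, forall x, A x -> c1 x = i -> A r /\ c1 r = i.
  move=> i; have [[r [Ar ri]]|n] := pselect (exists r, A r /\ c1 r = i); first by exists r.
  by exists 0 => x Ax xi; case: n; exists x.
apply: (few_fintype (col := fun x => (c1 x, c2 (x - r (c1 x))))).
  by rewrite card_prod !card_ord.
move=> x y Ax Ay [E1 E2].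
have [Ar Er] := rP _ _ Ax erefl; have [As Es] := rP _ _ Ay erefl.
have := H2 (x - r (c1 x)) (y - r (c1 y)).
rewrite -E1 /= opprB addrA subrK; apply=> //.
- by split; [exact: subgB|exact: H1].
- by split; [exact: subgB; rewrite // E1|apply: H1 => //; rewrite Er].
- by rewrite E2 E1.
Qed.

Lemma finS (X : Type) (D D' : set X) (f : X -> h) B B' :
  D' `<=` D -> B `<=` B' -> fin D f B -> fin D' f B'.
Proof.
move=> DD BB [k kP]; exists k.
by apply: (few_map (m := id)) kP => // y z _ _; exact: BB.
Qed.

Lemma finI (X : Type) (D : set X) (f : X -> h) B C :
  fin D f B -> fin D f C -> fin D f (B `&` C).
Proof. by move=> [k kP] [l lP]; exists (k * l)%N; exact: few_setI. Qed.

Lemma fin_trans A B C :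
  additive_subgroup A -> fin A id B -> fin (A `&` B) id C -> fin A id C.
Proof. by move=> sA [k kP] [l lP]; exists (k * l)%N; apply: few_trans lP. Qed.

Lemma finT (X : Type) (D : set X) (f : X -> h) B :
  (forall x y, D x -> D y -> B (f x - f y)) -> fin D f B.
Proof. by move=> H; exists 1%N, (fun=> ord0) => x y Dx Dy _; exact: H. Qed.

Lemma fin_reps (X : eqType) (D : set X) (f : X -> h) B :
  fin D f B ->
  exists s : seq X, (forall y, y \in s -> D y) /\
    forall x, D x -> exists2 y, y \in s & B (f x - f y).
Proof.
move=> [k [col H]].
(* [None] marks the colours that [D] misses, as [X] may be empty. *)
have /choice [r rP] : forall i : 'I_k, exists r : option X,
    if r is Some y then D y /\ col y = i else forall x, D x -> col x <> i.
  move=> i; have [[y yP]|n] := pselect (exists y, D y /\ col y = i); first by exists (Some y).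
  by exists None => x Dx xi; apply: n; exists x.
exists (pmap r (enum 'I_k)); split=> [y|x Dx].
  rewrite mem_pmap => /mapP[i _ E].
  by have := rP i; rewrite -E => -[].
case E: (r (col x)) (rP (col x)) => [y|] => [[Dy yx]|/(_ x Dx)//].
exists y; last exact: H.
by rewrite mem_pmap -E map_f // mem_enum.
Qed.

Lemma fin_setU (X : Type) (D D' : set X) (f : X -> h) B :
  fin D f B -> fin D' f B -> fin (D `|` D') f B.
Proof.
move=> [k [c1 H1]] [l [c2 H2]]; exists #|{: bool * 'I_k * 'I_l}|.
(* The first component records membership in [D], so that two points of equal colour can be compared
   within one of the two sets. *)
apply: (few_fintype (col := fun x => (`[< D x >], c1 x, c2 x))) => // x y Dx Dy [E E1 E2].
have [d|d] := pselect (D x).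
  by apply: H1 => //; apply/asboolP; rewrite -E; apply/asboolP.
have d' : ~ D y by move=> /asboolP; rewrite -E => /asboolP.
by apply: H2 => //; [case: Dx | case: Dy].
Qed.

Lemma fin_bigcup (X : Type) (Y : eqType) (D : Y -> set X) (s : seq Y) (f : X -> h) B :
  (forall y, y \in s -> fin (D y) f B) -> fin [set x | exists2 y, y \in s & D y x] f B.
Proof.
elim: s => [_|y s IH sP]; first by apply: finT => x z [].
have : fin (D y `|` [set x | exists2 y, y \in s & D y x]) f B.
  apply: fin_setU; first by apply: sP; rewrite mem_head.
  by apply: IH => z zs; apply: sP; rewrite inE zs orbT.
apply: finS => // x [z]; rewrite inE => /orP[/eqP->|zs] Dz; [by left | right].
by exists z.
Qed.

Lemma fin_bigcap (X : Type) (Y : eqType) (D : set X) (s : seq Y) (f : X -> h) (F : Y -> set h) :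
  (forall y, y \in s -> fin D f (F y)) -> fin D f [set x | forall y, y \in s -> F y x].
Proof.
elim: s => [_|y s IH sP]; first by apply: finT.
have : fin D f (F y `&` [set x | forall y, y \in s -> F y x]).
  apply: finI; first by apply: sP; rewrite mem_head.
  by apply: IH => z zs; apply: sP; rewrite inE zs orbT.
by apply: finS => // x [Fx Fs] z; rewrite inE => /orP[/eqP->|/Fs].
Qed.

Lemma fin_add (X : Type) (D : set X) (f f' : X -> h) B :
  additive_subgroup B -> fin D f B -> fin D f' B -> fin D (fun x => f x + f' x) B.
Proof.
move=> sB [k [c1 H1]] [l [c2 H2]]; exists #|{: 'I_k * 'I_l}|.
apply: (few_fintype (col := fun x => (c1 x, c2 x))) => // x y Dx Dy [E1 E2].
by rewrite opprD addrACA; apply: subgD => //; auto.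
Qed.

(* Representatives may lie outside of [A]: this is the first-order form of
   finite index. *)
Lemma few_covering A B k : additive_subgroup B -> A 0 ->
  few A id B k <-> exists s : k.-tuple h, forall x, A x -> exists i, B (x - tnth s i).
Proof.
move=> sB A0; split=> [[col H]|[s sP]].
  have /choice [r rP] : forall i : 'I_k, exists r, forall x, A x -> col x = i -> B (x - r).
    move=> i; have [[y [Ay yi]]|n] := pselect (exists y, A y /\ col y = i).
      by exists y => x Ax xi; apply: H; rewrite ?xi.
    by exists 0 => x Ax xi; case: n; exists x.
  exists [tuple r i | i < k] => x Ax; exists (col x); rewrite tnth_mktuple.
  exact: rP.
have [i0 _] := sP _ A0.
have /choice [col cP] : forall x, exists i, A x -> B (x - tnth s i).
  move=> x; have [/sP[i Bi]|n] := pselect (A x); first by exists i.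
  by exists i0 => /n.
exists col => x y /cP Bx /cP By E; rewrite /= -(subrKA (tnth s (col x))).
by apply: subgD => //; rewrite -opprB E; exact: subgN.
Qed.

Lemma fin_preim (X Y : Type) (D : set X) (f : X -> h) (D' : set Y) (f' : Y -> h)
    (m : Y -> X) B B' :
  (forall y, D' y -> D (m y)) ->
  (forall y z, D' y -> D' z -> B (f (m y) - f (m z)) -> B' (f' y - f' z)) ->
  fin D f B -> fin D' f' B'.
Proof. by move=> mD BB' [k kP]; exists k; exact: few_map mD BB' kP. Qed.

(** For a subgroup [B], the entries lie in pairwise distinct cosets; such sequences witness lower
    bounds on an index. *)
Definition separated (B : set h) (s : seq h) : Prop :=
  forall i j, (i < j < size s)%N -> ~ B (nth 0 s i - nth 0 s j).

Lemma separated_few A B k (s : seq h) :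
  few A id B k -> (forall x, x \in s -> A x) -> separated B s -> (size s <= k)%N.
Proof.
move=> [col H] sA sep.
have inj : injective (fun i : 'I_(size s) => col (nth 0 s i)).
  move=> i j E; apply: contrapT => /eqP ij.
  wlog lij : i j E ij / (i < j)%N => [wl|].
    have [l|l|l] := ltngtP i j; first exact: (wl i j E ij l).
      by apply: (wl j i (esym E)) l; rewrite eq_sym.
    by move/eqP: ij; apply; exact: val_inj.
  apply: (sep i j); first by rewrite lij /=.
  by apply: H => //; apply: sA; exact: mem_nth.
by have := leq_card _ inj; rewrite !card_ord.
Qed.

Lemma separated_rcons B (s : seq h) (x : h) :
  separated B s -> (forall y, y \in s -> ~ B (y - x)) -> separated B (rcons s x).
Proof.
move=> sep nB i j; rewrite size_rcons ltnS !nth_rcons => /andP[ij].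
rewrite leq_eqVlt => /orP [/eqP E|js].
  rewrite E in ij *; rewrite ij ltnn eqxx.
  by apply: nB; exact: mem_nth.
by rewrite js (ltn_trans ij js); apply: sep; rewrite ij.
Qed.

(** A separated sequence in [A] that could not be extended would meet every coset, and the index
    would be finite. *)
Lemma not_fin_separated A B :
  additive_subgroup B -> A 0 -> ~ fin A id B ->
  forall k, exists s : seq h, [/\ size s = k, forall x, x \in s -> A x & separated B s].
Proof.
move=> sB A0 nfin; elim=> [|k [s [sk sA sep]]].
  by exists [::]; split=> // i j; rewrite ltn0 andbF.
have [x Ax xP] : exists2 x, A x & forall y, y \in s -> ~ B (y - x).
  apply: contrapT => n; apply: nfin; exists (size s).
  apply/few_covering => //; exists (in_tuple s) => x Ax; apply: contrapT => nx.
  apply: n; exists x => // y /seq_tnthP [i ->] Bi; apply: nx; exists i.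
  exact: subgBC.
exists (rcons s x); split; first by rewrite size_rcons sk.
  by move=> y; rewrite mem_rcons inE => /orP[/eqP->|/sA].
exact: separated_rcons.
Qed.

End FiniteIndex.
(** * Definability inside a coded group *)

Section Coding.
Variables (L : language) (N : structure L) (h : zmodType) (n : nat).
Variable c : h -> n.-tuple N.

(** Variable [i] of the group becomes [n] variables of the structure, indexed by the pairs
    [(i, j)]. *)
Definition code (rho : nat -> h) (v : nat * 'I_n) : N := tnth (c (rho v.1)) v.2.

(** Indexing the variables by all of [nat] gives predicates of every arity the same type. *)
Definition hdef (P : (nat -> h) -> Prop) : Prop :=
  exists2 Q, dpred Q & forall rho, P rho <-> Q (code rho).

(* [c] is not required to be injective: for the group of sequences [nat -> g],
   coded in an ultrapower, it is not. *)
Record coding : Prop := Coding {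
  coding_congr : forall x y t, c x = c y -> c (x + t) = c (y + t);
  coding_range : definable (range c);
  coding_add : hdef (fun rho => c (rho 2%N) = c (rho 0%N + rho 1%N)) }.

Lemma hdef_ext (P Q : (nat -> h) -> Prop) :
  (forall rho, P rho <-> Q rho) -> hdef P -> hdef Q.
Proof. by move=> PQ [R dR H]; exists R => // rho; rewrite -PQ. Qed.

Lemma hdef_imp P Q : hdef P -> hdef Q -> hdef (fun rho => P rho -> Q rho).
Proof.
move=> [R dR H] [R' dR' H']; exists (fun e => R e -> R' e); first exact: dpred_imp.
by move=> rho; rewrite H H'.
Qed.

Lemma hdef_and P Q : hdef P -> hdef Q -> hdef (fun rho => P rho /\ Q rho).
Proof.
move=> [R dR H] [R' dR' H']; exists (fun e => R e /\ R' e); first exact: dpred_and.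
by move=> rho; rewrite H H'.
Qed.

Lemma hdef_or P Q : hdef P -> hdef Q -> hdef (fun rho => P rho \/ Q rho).
Proof.
move=> [R dR H] [R' dR' H']; exists (fun e => R e \/ R' e); first exact: dpred_or.
by move=> rho; rewrite H H'.
Qed.

Lemma hdef_not P : hdef P -> hdef (fun rho => ~ P rho).
Proof.
move=> [R dR H]; exists (fun e => ~ R e); first exact: dpred_not.
by move=> rho; rewrite H.
Qed.

Lemma hdef_False : hdef (fun=> False).
Proof. by exists (fun=> False) => //; exact: dpred_False. Qed.

Lemma hdef_True : hdef (fun=> True).
Proof. by exists (fun=> True) => //; exact: dpred_True. Qed.

Lemma hdef_has (Y : eqType) (s : seq Y) (P : Y -> (nat -> h) -> Prop) :
  (forall y, hdef (P y)) -> hdef (fun rho => exists2 y, y \in s & P y rho).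
Proof.
move=> dP; elim: s => [|y s IH].
  by apply: hdef_ext hdef_False => rho; split=> // -[].
apply: hdef_ext (hdef_or (dP y) IH) => rho; split.
  move=> [Py|[z zs Pz]]; first by exists y; rewrite // mem_head.
  by exists z; rewrite // inE zs orbT.
by move=> [z]; rewrite inE => /orP[/eqP->|zs Pz]; [left | right; exists z].
Qed.

Lemma hdef_definable3 (S : set ((n + n + n).-tuple N)) :
  definable S ->
  hdef (fun rho => S (cat_tuple (cat_tuple (c (rho 0%N)) (c (rho 1%N))) (c (rho 2%N)))).
Proof.
move=> /definable_dpred dS.
pose s (i : 'I_(n + n + n)) : nat * 'I_n := match fintype.split i with
  | inl i' => match fintype.split i' with inl j => (0%N, j) | inr j => (1%N, j) end
  | inr j => (2%N, j) end.
exists (fun e => S [tuple (e \o s) i | i < n + n + n]); first exact: (dpred_ren s dS).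
move=> rho; rewrite (_ : mktuple _ =
  cat_tuple (cat_tuple (c (rho 0%N)) (c (rho 1%N))) (c (rho 2%N))) //.
apply: eq_from_tnth => i; rewrite tnth_mktuple /= /s -[in RHS](splitK i).
case: (fintype.split i) => [i'|j] /=; last by rewrite tnth_rshift.
rewrite tnth_lshift -[in RHS](splitK i').
by case: (fintype.split i') => j /=; rewrite ?tnth_lshift ?tnth_rshift.
Qed.

Lemma hdef_subst (P : (nat -> h) -> Prop) (s : nat -> nat + h) :
  hdef P -> hdef (fun rho => P (fun i => valuation rho (s i))).
Proof.
move=> [Q dQ H].
exists (fun e => Q (fun v => valuation e (match s v.1 with
  inl i => inl (i, v.2) | inr a => inr (tnth (c a) v.2) end))); first exact: dpred_subst.
move=> rho; rewrite H (_ : code _ = fun v => valuation (code rho)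
  (match s v.1 with inl i => inl (i, v.2) | inr a => inr (tnth (c a) v.2) end)) //.
by apply: funext => -[i j]; rewrite /code /=; case: (s i).
Qed.

Lemma hdef_ren (P : (nat -> h) -> Prop) (s : nat -> nat) :
  hdef P -> hdef (fun rho => P (fun i => rho (s i))).
Proof. exact: (@hdef_subst P (fun i => inl (s i))). Qed.

Lemma hdef_definable_img (A : set h) :
  definable (range c) -> hdef (fun rho => A (rho 0%N)) -> definable (c @` A).
Proof.
move=> dr [Q dQ H].
(* The predicate depends on variable 0 alone, so all variables may be given the same value. *)
have -> : c @` A = range c `&` [set t | Q (fun v => tnth t v.2)].
  apply/seteqP; split=> [_ [x Ax <-]|_ [[x _ <-]]] /=.
    by split; [exists x | apply/(H (fun=> x))].
  by move=> Qx; exists x => //; apply/(H (fun=> x)).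
apply: definable_setI => //; apply/definable_dpred.
apply: dpred_ext (dpred_ren (fun v : nat * 'I_n => v.2) dQ) => e /=.
rewrite (_ : (fun v => tnth _ _) = e \o snd) //.
by apply: funext => v; rewrite tnth_mktuple.
Qed.

Lemma hdef_definable_graph (R : h -> h -> Prop) :
  definable (range c) -> hdef (fun rho => R (rho 0%N) (rho 1%N)) ->
  definable (graph_of (fun u v => exists x y, [/\ R x y, u = c x & v = c y])).
Proof.
move=> dr [Q dQ H].
(* The predicate depends on variables 0 and 1 only, so all variables after 0 may share the value
   [v]. *)
pose r (u v : n.-tuple N) (w : nat * 'I_n) : N :=
  if w.1 is 0%N then tnth u w.2 else tnth v w.2.
have dG : definable (graph_of (fun u v => Q (r u v))).
  apply/definable_graph_of.
  pose s (w : nat * 'I_n) : 'I_n + 'I_n := if w.1 is 0%N then inl w.2 else inr w.2.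
  apply: dpred_ext (dpred_ren s dQ) => e.
  rewrite (_ : r _ _ = e \o s) //; apply: funext => -[[|i] j];
    by rewrite /r /= tnth_mktuple.
have cr x y : r (c x) (c y) = code (fun i => if i is 0%N then x else y).
  by apply: funext => -[[|i] j].
have := definable_graph_and dG
  (definable_graph_and (definable_graph_l n dr) (definable_graph_r n dr)).
congr definable; congr graph_of; apply: funext => u; apply: funext => v.
apply: propext; split=> [[Quv [[x _ Ex] [y _ Ey]]]|[x [y [Rxy -> ->]]]].
  by exists x, y; split=> //; apply/(H (fun i => if i is 0%N then x else y)); rewrite -cr Ex Ey.
by split; [rewrite cr; apply/H | split; [exists x|exists y]].
Qed.

(** * Quantifiers, terms and indices in a coded group *)

Hypothesis C : coding.

(** A quantifier over the group becomes a block of [n] quantifiers over the structure, relativized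
    to the range of [c]. *)
Lemma hdef_all (P : h -> (nat -> h) -> Prop) :
  hdef (fun rho => P (rho 0%N) (fun i => rho i.+1)) ->
  hdef (fun rho => forall x, P x rho).
Proof.
move=> [Q dQ H].
have dr : dpred (fun e : 'I_n -> N => range c [tuple e i | i < n]).
  exact/definable_dpred/coding_range.
pose glue (t : 'I_n -> N) (e : nat * 'I_n -> N) (v : nat * 'I_n) : N :=
  if v.1 is i.+1 then e (i, v.2) else t v.2.
exists (fun e => forall t : 'I_n -> N, range c [tuple t i | i < n] -> Q (glue t e)).
  apply: (@dpred_all_tuple _ _ _ _ (fun t e => range c [tuple t i | i < n] -> Q (glue t e))).
  apply: dpred_imp; first exact: (dpred_ren inl dr).
  pose s (v : nat * 'I_n) : 'I_n + (nat * 'I_n) :=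
    if v.1 is i.+1 then inr (i, v.2) else inl v.2.
  apply: dpred_ext (dpred_ren s dQ) => e; rewrite (_ : e \o s = glue (e \o inl) (e \o inr)) //.
  by apply: funext => -[[|i] j].
move=> rho; have E x : glue (tnth (c x)) (code rho) =
    code (fun i => if i is j.+1 then rho j else x) by apply: funext => -[[|i] j].
split=> [Pr t [x _ Ex]|Qr x].
  have -> : t = tnth (c x) by apply: funext => j; rewrite Ex tnth_mktuple.
  by rewrite E -H.
apply/(H (fun i => if i is j.+1 then rho j else x)); rewrite -E; apply: Qr.
by exists x; rewrite // mktuple_tnth.
Qed.

Lemma hdef_ex (P : h -> (nat -> h) -> Prop) :
  hdef (fun rho => P (rho 0%N) (fun i => rho i.+1)) ->
  hdef (fun rho => exists x, P x rho).
Proof.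
move=> dP.
have d : hdef (fun rho => ~ forall x, ~ P x rho).
  by apply: hdef_not; apply: hdef_all; exact: hdef_not.
apply: hdef_ext d => rho; split=> [h0|[x Px] /(_ x)//].
by apply: contrapT => /forallNP.
Qed.

(** The graph is taken up to equality of codes, as [c] may fail to be injective. *)
Definition hterm (t : (nat -> h) -> h) : Prop :=
  hdef (fun rho => c (rho 0%N) = c (t (fun i => rho i.+1))).

Lemma hdef_ceq i j : hdef (fun rho => c (rho i) = c (rho j)).
Proof.
exists (fun e => forall k : 'I_n, e (i, k) = e (j, k)).
  by apply: dpred_forall_fin => k; exact: dpred_eq.
move=> rho; split=> [E k|E]; first by rewrite /code /= E.
by apply: eq_from_tnth => k; exact: E.
Qed.

Lemma hterm_var i : hterm (fun rho => rho i).
Proof. exact: hdef_ceq. Qed.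

Lemma hterm_const a : hterm (fun=> a).
Proof.
exact: (hdef_subst (fun i => if i is 0%N then inl 0%N else inr a) (hdef_ceq 0 1)).
Qed.

(** A definable predicate sees its arguments only through their codes. *)
Lemma hdef_congr (P : h -> (nat -> h) -> Prop) x y rho :
  hdef (fun rho => P (rho 0%N) (fun i => rho i.+1)) -> c x = c y -> P x rho -> P y rho.
Proof.
move=> [Q _ H] E /(H (fun i => if i is j.+1 then rho j else x)) Qx.
apply/(H (fun i => if i is j.+1 then rho j else y)).
rewrite (_ : code _ = code (fun i => if i is j.+1 then rho j else x)) //.
by apply: funext => -[[|i] j]; rewrite /code /= ?E.
Qed.

(** The term is replaced by a quantified [x] with the same code; [hdef_congr] transfers [P] back to
    the term. *)
Lemma hdef_app (P : h -> (nat -> h) -> Prop) (t : (nat -> h) -> h) :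
  hdef (fun rho => P (rho 0%N) (fun i => rho i.+1)) -> hterm t ->
  hdef (fun rho => P (t rho) rho).
Proof.
move=> dP dt.
have d : hdef (fun rho => exists x, c x = c (t rho) /\ P x rho).
  by apply: hdef_ex; apply: hdef_and.
apply: hdef_ext d => rho; split=> [[x [E]]|Pt]; first exact: hdef_congr.
by exists (t rho).
Qed.

Lemma hdef_app1 (A : set h) (t : (nat -> h) -> h) :
  hdef (fun rho => A (rho 0%N)) -> hterm t -> hdef (fun rho => A (t rho)).
Proof. exact: (@hdef_app (fun x _ => A x)). Qed.

Lemma hdef_app2 (F : h -> h -> Prop) (t u : (nat -> h) -> h) :
  hdef (fun rho => F (rho 0%N) (rho 1%N)) -> hterm t -> hterm u ->
  hdef (fun rho => F (t rho) (u rho)).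
Proof.
move=> dF dt du; apply: (@hdef_app (fun x rho => F x (u rho))) => //.
apply: (@hdef_app (fun y rho => F (rho 0%N) y)).
  exact: (hdef_ren (fun i => if i is 0%N then 1%N else 0%N) dF).
exact: (hdef_ren (fun i => if i is j.+1 then j.+2 else 0%N) du).
Qed.

Lemma hterm_app2 (f : h -> h -> h) (t u : (nat -> h) -> h) :
  hdef (fun rho => c (rho 2%N) = c (f (rho 0%N) (rho 1%N))) ->
  hterm t -> hterm u -> hterm (fun rho => f (t rho) (u rho)).
Proof.
move=> df dt du.
rewrite /hterm.
have dt' := hdef_ren (fun i => if i is j.+1 then j.+2 else 0%N) dt.
apply: (@hdef_app (fun x rho => c (rho 0%N) = c (f x (u (fun i => rho i.+1))))
  (fun rho => t (fun i => rho i.+1))) => //.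
apply: (@hdef_app (fun y rho => c (rho 1%N) = c (f (rho 0%N) y))
  (fun rho => u (fun i => rho i.+2))); last first.
  exact: (hdef_ren (fun i => if i is j.+1 then j.+3 else 0%N) du).
exact: (hdef_ren (fun i => match i with 0 => 1 | 1 => 0 | _ => 2 end)%N df).
Qed.

Lemma hterm_add t u : hterm t -> hterm u -> hterm (fun rho => t rho + u rho).
Proof. by apply: hterm_app2; exact: coding_add. Qed.

(** The opposite is the solution of an additive equation, which [coding_congr] solves up to
    codes. *)
Lemma hterm_opp t : hterm t -> hterm (fun rho => - t rho).
Proof.
move=> dt; rewrite /hterm.
have dt' : hterm (fun rho => t (fun i => rho i.+1)).
  exact: (hdef_ren (fun i => if i is j.+1 then j.+2 else 0%N) dt).
have d : hdef (fun rho => c 0 = c (rho 0%N + t (fun i => rho i.+1))).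
  apply: (hdef_app (P := fun x rho => c x = c (rho 0%N + t (fun i => rho i.+1)))).
    exact: (hterm_add (hterm_var 0) dt').
  exact: hterm_const.
apply: hdef_ext d => rho; set s := t _; split=> E.
  by have := coding_congr C (- s) E; rewrite add0r addrK.
by have := coding_congr C s E; rewrite addNr.
Qed.

Lemma hterm_sub t u : hterm t -> hterm u -> hterm (fun rho => t rho - u rho).
Proof. by move=> dt du; apply: hterm_add => //; exact: hterm_opp. Qed.

(* [R] accumulates the cosets already chosen in the recursion on [k]. *)
Lemma hdef_covered (k : nat) (P R : h -> (nat -> h) -> Prop)
    (E : h -> h -> (nat -> h) -> Prop) :
  hdef (fun rho => P (rho 0%N) (fun i => rho i.+1)) ->
  hdef (fun rho => R (rho 0%N) (fun i => rho i.+1)) ->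
  hdef (fun rho => E (rho 0%N) (rho 1%N) (fun i => rho i.+2)) ->
  hdef (fun rho => exists s : k.-tuple h,
    forall x, P x rho -> R x rho \/ exists i, E x (tnth s i) rho).
Proof.
elim: k P R E => [|k IH] P R E dP dR dE.
  have d : hdef (fun rho => forall x, P x rho -> R x rho).
    by apply: hdef_all; exact: hdef_imp.
  apply: hdef_ext d => rho; split=> [H|[s H] x Px]; first by exists [tuple] => x /H; left.
  by case: (H x Px) => // -[[]].
pose sh (rho : nat -> h) i := rho i.+1.
have d : hdef (fun rho => exists y, exists s : k.-tuple h, forall x, P x rho ->
    (R x rho \/ E x y rho) \/ exists i, E x (tnth s i) rho).
  apply: hdef_ex.
  apply: (IH (fun x rho => P x (sh rho))
    (fun x rho => R x (sh rho) \/ E x (rho 0%N) (sh rho)) (fun x z rho => E x z (sh rho))).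
  - exact: (hdef_ren (fun i => if i is j.+1 then j.+2 else 0%N) dP).
  - apply: hdef_or; last exact: dE.
    exact: (hdef_ren (fun i => if i is j.+1 then j.+2 else 0%N) dR).
  - exact: (hdef_ren (fun i => match i with 0 => 0 | 1 => 1 | j.+2 => j.+3 end)%N dE).
apply: hdef_ext d => rho; split=> [[y [s H]]|[s H]].
  exists (cons_tuple y s) => x /H [[Rx|Ex]|[i Ex]]; [by left|right|right].
    by exists ord0; rewrite tnth0.
  by exists (lift ord0 i); rewrite tnthS.
exists (thead s), [tuple of behead s] => x /H [Rx|[i]]; first by left; left.
case: (unliftP ord0 i) => [j|] -> Ex; last by left; right.
right; exists j.
by rewrite (tuple_eta s) tnthS in Ex; exact: Ex.
Qed.

(** By [few_covering], the bound on the index amounts to a covering by [k] cosets, which is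
    first-order; [hdef_covered] starts with nothing covered. *)
Lemma hdef_few (k : nat) (A : set h) (F : h -> h -> Prop) :
  (forall x, additive_subgroup (F x)) -> A 0 ->
  hdef (fun rho => A (rho 0%N)) -> hdef (fun rho => F (rho 0%N) (rho 1%N)) ->
  hdef (fun rho => few A id (F (rho 0%N)) k).
Proof.
move=> sF A0 dA dF.
have d : hdef (fun rho => exists s : k.-tuple h, forall x, A x ->
    False \/ exists i, F (rho 0%N) (x - tnth s i)).
  apply: (@hdef_covered k (fun x _ => A x) (fun _ _ => False)
    (fun x y rho => F (rho 0%N) (x - y))) => //; first exact: hdef_False.
  apply: hdef_app2 => //; first exact: hterm_var.
  by apply: hterm_sub; exact: hterm_var.
apply: hdef_ext d => rho; rewrite few_covering //.
by split=> -[s H]; exists s => x /H; [case | right].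
Qed.

End Coding.
(** * Dimension and index *)

Section CodedDimension.
Variables (L : language) (T : theory L).
Variable dim : forall (M : structure L) (n : nat), set (set (n.-tuple M)) -> dimension.
Hypothesis dimP : is_dimension T dim.
Variables (N : structure L) (NT : is_model T N).
Variables (h : zmodType) (n : nat) (c : h -> n.-tuple N).
Hypothesis C : coding c.
Implicit Types A B : set h.

Local Notation def A := (hdef c (fun rho => A (rho 0%N))).

Definition cdim A : dimension := ddim dim (c @` A).

Lemma def_saturated A x y : def A -> c x = c y -> A x -> A y.
Proof. exact: (@hdef_congr _ _ _ _ _ (fun x _ => A x) x y (fun=> x)). Qed.

Lemma definable_img A : def A -> definable (c @` A).
Proof. by apply: hdef_definable_img; exact: coding_range. Qed.

Lemma cdim_some A x : def A -> A x -> exists k, cdim A = Some k.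
Proof.
move=> dA Ax; apply: (ddim_nonempty dimP NT); first exact: definable_img.
by exists (c x); exists x.
Qed.

Lemma cdim_mono A B : def A -> def B -> A `<=` B -> dim_le (cdim A) (cdim B).
Proof.
by move=> dA dB AB; apply: (ddim_mono dimP) => //; try exact: definable_img; exact: image_subset.
Qed.

Lemma cdimU A B : def A -> def B -> cdim (A `|` B) = dim_max (cdim A) (cdim B).
Proof. by move=> dA dB; rewrite /cdim image_setU (ddimU dimP) //; exact: definable_img. Qed.

(** The cosets of [B] in [A] form an infinite quotient. A translation maps each coset onto [B], so
    each has dimension at least [k], and [ddim_quotient_infinite] applies. *)
Lemma cdim_infinite_index A B k :
  additive_subgroup A -> additive_subgroup B -> B `<=` A -> def A -> def B ->
  ~ fin A id B -> cdim B = Some k -> dim_le (Some k.+1) (cdim A).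
Proof.
move=> sA sB BA dA dB nfin Bk.
(* A definable subgroup contains the differences of elements with equal codes, so the coset relation
   passes to codes. *)
have Beq x y : c x = c y -> B (x - y).
  move=> E; apply: (def_saturated dB _ (subg0 sB)).
  by have := coding_congr C (- y) E; rewrite subrr => ->.
pose R x y := [/\ A x, A y & B (x - y)].
have dR : hdef c (fun rho => R (rho 0%N) (rho 1%N)).
  have d : hdef c (fun rho => A (rho 0%N) /\ (A (rho 1%N) /\ B (rho 0%N - rho 1%N))).
    apply: hdef_and => //; apply: hdef_and; first exact: (hdef_ren (fun=> 1%N) dA).
    by apply: hdef_app1 => //; apply: hterm_sub => //; exact: hterm_var.
  by apply: hdef_ext d => rho; split=> [[? [? ?]]|[]].
have dE := hdef_definable_graph (coding_range C) dR.
set E := (fun u v => exists x y, _) in dE.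
have EP x y : A x -> A y -> E (c x) (c y) <-> B (x - y).
  move=> Ax Ay; split=> [[x' [y' [[_ _ B'] /Beq Bx /esym /Beq By]]]|Bxy]; last by exists x, y.
  by apply: (subgBt sB) Bx _; apply: (subgBt sB) B' _.
apply: (ddim_quotient_infinite dimP NT (E := E)) => //.
- exact: definable_img.
- split.
  + by move=> _ [x Ax <-]; apply/EP; rewrite // subrr; exact: subg0.
  + by move=> _ _ [x Ax <-] [y Ay <-] /(EP _ _ Ax Ay) /(subgBC sB) /(EP _ _ Ay Ax).
  + move=> _ _ _ [x Ax <-] [y Ay <-] [z Az <-] /(EP _ _ Ax Ay) Bxy /(EP _ _ Ay Az) Byz.
    by apply/EP => //; exact: (subgBt sB) Bxy Byz.
- by exists (c 0); exists 0 => //; exact: subg0.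
(* A numbering of a finite quotient would colour [A], each element by the number of its class. *)
- move=> [k' /card_set_bijP [f [ff finj _]]]; apply: nfin; exists k'.
  pose cl x := [set v | (c @` A) v /\ E (c x) v].
  have clP x : A x -> quotient_set (c @` A) E (cl x) by move=> Ax; exists (c x) => //; exists x.
  have fk x : A x -> (f (cl x) < k')%N by move=> /clP /ff.
  have k0 : (0 < k')%N by apply: leq_ltn_trans (fk 0 (subg0 sA)).
  exists (fun x => insubd (Ordinal k0) (f (cl x))) => x y Ax Ay /(congr1 val).
  rewrite /= !val_insubd !fk // => fxy.
  have Exy : cl x = cl y by apply: finj => //; apply: mem_set; exact: clP.
  apply/EP => //.
  have [] : cl x (c y) by rewrite Exy; split; [exists y | apply/EP; rewrite // subrr; exact: subg0].
  by [].
- move=> _ [x Ax <-]; rewrite -Bk.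
  have cosE : [set v | (c @` A) v /\ E (c x) v] = c @` [set y | A y /\ B (y - x)].
    apply/seteqP; split=> [_ [[y Ay <-] /(EP _ _ Ax Ay) Bxy]|_ [y [Ay Byx] <-]].
      by exists y => //; split=> //; exact: (subgBC sB).
    by split; [exists y | apply/EP => //; exact: (subgBC sB)].
  rewrite cosE.
  have dcos : def [set y | A y /\ B (y - x)].
    apply: hdef_and => //; apply: hdef_app1 => //.
    by apply: (hterm_sub C); [exact: hterm_var | exact: hterm_const].
  pose S y z := (A y /\ B (y - x)) /\ c z = c (y - x).
  have dS : hdef c (fun rho => S (rho 0%N) (rho 1%N)).
    apply: hdef_and => //.
    apply: (hdef_app C (P := fun y rho => c (rho 1%N) = c y)); first exact: hdef_ceq.
    by apply: (hterm_sub C); [exact: hterm_var | exact: hterm_const].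
  (* Translation by [- x], read on codes; its values outside the coset are arbitrary. *)
  have /choice [F FP] : forall u, exists v, (c @` [set y | A y /\ B (y - x)]) u ->
      exists y, [/\ A y, B (y - x), u = c y & v = c (y - x)].
    move=> u; have [[y [Ay By] <-]|nu] := pselect ((c @` [set y | A y /\ B (y - x)]) u).
      by exists (c (y - x)) => _; exists y.
    by exists u => /nu.
  have Fc y : A y -> B (y - x) -> F (c y) = c (y - x).
    move=> Ay By; have [|y' [_ _ E' ->]] := FP (c y); first by exists y.
    exact: coding_congr (esym E').
  apply: (ddim_image dimP NT (F := F)).
  + exact: definable_img.
  + exact: definable_img.
  + have := hdef_definable_graph (coding_range C) dS.
    congr definable; congr graph_of; apply: funext => u; apply: funext => v.
    apply: propext; split=> [[y [z [[[Ay By] E1] -> ->]]]|[[y [Ay By] <-] <-]].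
      by split; [exists y | rewrite Fc].
    by exists y, (y - x); split=> //; rewrite Fc.
  + by move=> _ [y [Ay By] <-]; rewrite Fc //; exists (y - x).
  + move=> _ [z Bz <-]; exists (c (z + x)).
      by exists (z + x) => //; split; [apply: subgD => //; exact: BA | rewrite addrK].
    by rewrite Fc ?addrK //; apply: subgD => //; exact: BA.
Qed.

(* B. H. Neumann's covering lemma; here it follows from additivity of the
   dimension under unions. *)
Lemma not_covered A (F : h -> set h) (s : seq h) :
  additive_subgroup A -> def A ->
  (forall x, x \in s -> [/\ additive_subgroup (F x), def (F x) & ~ fin A id (F x)]) ->
  exists2 y, A y & forall x, x \in s -> ~ F x y.
Proof.
move=> sA dA sP; apply: contrapT => ncov.
have [d Ad] := cdim_some dA (subg0 sA).
pose V (s : seq h) := [set y | A y /\ exists2 x, x \in s & F x y].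
(* The covered part of [A] keeps a smaller dimension than [A]: each piece drops, and a union takes
   the maximum. *)
have /(_ s) VP : forall s, (forall x, x \in s ->
      [/\ additive_subgroup (F x), def (F x) & ~ fin A id (F x)]) ->
    def (V s) /\ ~~ dim_le (Some d) (cdim (V s)).
  elim=> [|x t IH] tP.
    have E : V [::] = set0 by apply/seteqP; split=> // y [_ []].
    rewrite E; split; first exact: hdef_False.
    by rewrite /cdim image_set0 /ddim /singletons image_set0 (dim_empty dimP).
  have [|dV Vd] := IH; first by move=> y yt; apply: tP; rewrite inE yt orbT.
  have [sF dF nF] := tP _ (mem_head x t).
  have dAF : def (A `&` F x) by exact: hdef_and.
  have E : V (x :: t) = (A `&` F x) `|` V t.
    apply/seteqP; split=> y.
      move=> [Ay [z]]; rewrite inE => /orP[/eqP-> Fz|zt Fz]; [by left|right].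
      by split=> //; exists z.
    case=> [[Ay Fy]|[Ay [z zt Fz]]]; split=> //; first by exists x; rewrite // mem_head.
    by exists z; rewrite // inE zt orbT.
  rewrite E; split; first exact: hdef_or.
  rewrite cdimU //.
  have [k kE] : exists k, cdim (A `&` F x) = Some k.
    by apply: (cdim_some dAF (x := 0)); split; exact: subg0.
  have lt : dim_le (Some k.+1) (cdim A).
    apply: (cdim_infinite_index _ _ _ _ dAF) => //; first exact: subgI.
    by apply: contra_not nF; apply: finS => // y [].
  rewrite Ad /= in lt; rewrite kE /dim_max; case: ifP => // _ /=.
  by rewrite -ltnNge.
have [//|dV] := VP; rewrite -Ad (_ : V s = A) ?dim_le_refl //.
apply/seteqP; split=> [y []//|y Ay]; split=> //.
apply: contrapT => ny; apply: ncov; exists y => // x xs Fx; apply: ny.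
by exists x.
Qed.

(* Minimality of the dimension makes every further intersection of finite
   index. *)
Lemma chain_condition A (J : set h) (F : h -> set h) :
  additive_subgroup A -> def A ->
  (forall x, J x -> additive_subgroup (F x) /\ def (F x)) ->
  exists s : seq h, (forall x, x \in s -> J x) /\
    let H := [set y | A y /\ forall x, x \in s -> F x y] in
    [/\ additive_subgroup H, def H & forall x, J x -> fin H id (F x)].
Proof.
move=> sA dA FP.
pose H (s : seq h) := [set y | A y /\ forall x, x \in s -> F x y].
have Hcons x s : H (x :: s) = H s `&` F x.
  apply/seteqP; split=> y.
    move=> [Ay Fy]; split; last by apply: Fy; rewrite mem_head.
    by split=> // z zs; apply: Fy; rewrite inE zs orbT.
  by move=> [[Ay Fy] Fx]; split=> // z; rewrite inE => /orP[/eqP->//|/Fy].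
have HP s : (forall x, x \in s -> J x) -> additive_subgroup (H s) /\ def (H s).
  elim: s => [|x s IH] sJ.
    have -> : H [::] = A by apply/seteqP; split=> [y []//|y Ay]; split.
    by [].
  have [|sH dH] := IH; first by move=> y ys; apply: sJ; rewrite inE ys orbT.
  have [sF dF] := FP x (sJ _ (mem_head x s)).
  by rewrite Hcons; split; [exact: subgI | exact: hdef_and].
have [d Ad] : exists d, exists s, (forall x, x \in s -> J x) /\ cdim (H s) = Some d.
  have [d dE] := cdim_some (HP [::] (fun _ h => match notF h with end)).2
    (subg0 (HP [::] (fun _ h => match notF h with end)).1).
  by exists d, [::].
pose P d := `[< exists s, (forall x, x \in s -> J x) /\ cdim (H s) = Some d >].
have exP : exists d, P d by exists d; apply/asboolP.
case: (ex_minnP exP) => m /asboolP [s [sJ sm]] mmin.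
exists s; split=> //; have [sH dH] := HP _ sJ; split=> // x Jx; apply: contrapT => nfin.
have xsJ y : y \in x :: s -> J y by rewrite inE => /orP[/eqP->|/sJ].
have [sH' dH'] := HP _ xsJ.
have [k kE] := cdim_some dH' (subg0 sH').
have : dim_le (Some k.+1) (cdim (H s)).
  apply: (cdim_infinite_index _ _ _ _ dH') => //; first by rewrite Hcons => y [].
  by apply: contra_not nfin; apply: finS => //; rewrite Hcons => y [].
rewrite sm /= ltnNge mmin //; apply/asboolP.
by exists (x :: s).
Qed.

End CodedDimension.
(** * Uniform bounds on finite indices *)

Section StarCoding.
Variables (L : language) (M : structure L) (g : zmodType) (n : nat).
Variables (c : g -> n.-tuple M) (C : coding c).
Variables (U : set_system nat) (UU : UltraFilter U).

(** A formula has finitely many variables, so agreement of each variable on its own set of [U] gives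
    agreement of all of them on one set of [U]. *)
Lemma dpred_eventually (I : Type) (P : (I -> M) -> Prop) (e e' : nat -> I -> M) :
  dpred P -> (forall v, U [set i | e i v = e' i v]) ->
  U [set i | P (e i)] -> U [set i | P (e' i)].
Proof.
move=> [K [phi [s H]]] ee'.
have : U [set i | forall j : 'I_K, valuation (e i) (s j) = valuation (e' i) (s j)].
  apply: ultra_ord => j; case: (s j) => [v|a] /=; first exact: ee'.
  exact: filterE.
apply: filterS2 => i /= E; rewrite !H.
rewrite (_ : [tuple valuation (e i) (s j) | j < K] =
  [tuple valuation (e' i) (s j) | j < K]) //.
by apply: eq_from_tnth => j; rewrite !tnth_mktuple E.
Qed.

(** Sequences stand for the elements of the ultrapower of [g] without passing to classes; those
    whose codes agree on a set of [U] get the same code. *)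
Definition star_code (x : nat -> g) : n.-tuple (ultrapower M U) :=
  [tuple cls U (fun i => tnth (c (x i)) j) | j < n].

Lemma star_code_eq x y : star_code x = star_code y <-> U [set i | c (x i) = c (y i)].
Proof.
split=> [E|E].
  have : U [set i | forall j : 'I_n, tnth (c (x i)) j = tnth (c (y i)) j].
    apply: ultra_ord => j; apply/(cls_eq UU).
    by have := congr1 (fun t => tnth t j) E; rewrite !tnth_mktuple.
  by apply: filterS => i; exact: eq_from_tnth.
apply: eq_from_tnth => j; rewrite !tnth_mktuple; apply/(cls_eq UU).
by apply: filterS E => i /= ->.
Qed.

(** The representatives read by [dpred_star] agree with the actual codes on a set of [U] for each
    variable, which suffices by [dpred_eventually]. *)
Lemma hdef_star (P : (nat -> g) -> Prop) :
  hdef c P -> hdef star_code (fun rho => U [set i | P (fun k => rho k i)]).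
Proof.
move=> [Q dQ H]; exists (fun e => U [set i | Q (fun v => rep (e v) i)]).
  exact: dpred_star.
move=> rho; have E v : U [set i | rep (code star_code rho v) i =
    code c (fun k => rho k i) v].
  by rewrite /code tnth_mktuple; exact: rep_cls.
split=> h.
  apply: (dpred_eventually dQ (e := fun i => code c (fun k => rho k i))).
    by move=> v; apply: filterS (E v) => i /= ->.
  by apply: filterS h => i /= /H.
have := dpred_eventually dQ E h.
by apply: filterS => i /= /H.
Qed.

Definition star (A : set g) : set (nat -> g) := [set x | U [set i | A (x i)]].

(** This gives [ddim_star] its meaning for the coded group of sequences. A tuple in the extension is
    lifted by choosing an element of [A] index by index. *)
Lemma star_code_img (A : set g) : star_code @` star A = star_set (U := U) (c @` A).
Proof.
apply/seteqP; split=> [_ [x Ax <-]|t].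
  have E : U [set i | component (star_code x) i = c (x i)].
    apply: filterS (ultra_ord UU (P := fun j i => rep (tnth (star_code x) j) i =
      tnth (c (x i)) j) _) => [i h|j].
      by apply: eq_from_tnth => j; rewrite tnth_mktuple h.
    by rewrite tnth_mktuple; exact: rep_cls.
  by apply: filterS2 E Ax => i /= -> Ax; exists (x i).
move=> tA.
have : U [set i | exists x, A x /\ c x = component t i].
  by apply: filterS tA => i [x Ax E]; exists x.
case/(ultra_exists UU (inhabits 0)) => x xP; exists x.
  by apply: filterS xP => i [].
apply: eq_from_tnth => j; rewrite tnth_mktuple -[RHS]cls_rep; apply/(cls_eq UU).
by apply: filterS xP => i /= [_ ->]; rewrite tnth_mktuple.
Qed.

Lemma definable_star_set (k : nat) (A : set (k.-tuple M)) :
  definable A -> definable (star_set (U := U) A).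
Proof. by move=> [m [phi [a ->]]]; exists m, phi, (diag U a); exact: star_def_set. Qed.

Lemma star_coding : coding star_code.
Proof.
split.
- move=> x y t /star_code_eq E; apply/star_code_eq; apply: filterS E => i.
  exact: coding_congr.
- have -> : range star_code = star_set (U := U) (range c).
    rewrite -star_code_img; congr (_ @` _); apply/seteqP; split=> // x _.
    exact: filterE.
  exact/definable_star_set/coding_range.
- apply: hdef_ext (hdef_star (coding_add C)) => rho.
  by rewrite star_code_eq.
Qed.

Lemma star_subgroup (F : nat -> set g) :
  (forall i, additive_subgroup (F i)) ->
  additive_subgroup [set x : nat -> g | U [set i | F i (x i)]].
Proof.
move=> sF; split=> [|x y Fx Fy]; first by apply: filterE => i; exact: subg0.
by apply: filterS2 Fx Fy => i /=; exact: subgB.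
Qed.

End StarCoding.

Section UniformBound.
Variables (L : language) (T : theory L).
Variable dim : forall (M : structure L) (n : nat), set (set (n.-tuple M)) -> dimension.
Hypothesis dimP : is_dimension T dim.
Variables (M : structure L) (MT : is_model T M).
Variables (g : zmodType) (n : nat) (c : g -> n.-tuple M).
Hypothesis C : coding c.

Local Notation def A := (hdef c (fun rho => A (rho 0%N))).

(* Unbounded finite indices give, for each [K], a chain of intersections of
   length [dim A + 1] all of whose indices exceed [K]; in an ultrapower these
   become infinite, and the chain contradicts the dimension of [A]. *)
Theorem uniform_index_bound (A : set g) (F : g -> set g) :
  additive_subgroup A -> def A ->
  (forall x, additive_subgroup (F x)) -> hdef c (fun rho => F (rho 0%N) (rho 1%N)) ->
  exists k, forall x, fin A id (F x) -> few A id (F x) k.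
Proof.
move=> sA dA sF dF; apply: contrapT => nbd.
have unbd k : exists x, fin A id (F x) /\ ~ few A id (F x) k.
  apply: contrapT => nx; apply: nbd; exists k => x fx; apply: contrapT => nf.
  by apply: nx; exists x.
pose H (s : nat -> g) j := [set y | A y /\ forall i, (i < j)%N -> F (s i) y].
have HS s j : H s j.+1 = H s j `&` F (s j).
  apply/seteqP; split=> y.
    by move=> [Ay Fy]; split; [split=> // i ij; apply: Fy; exact: ltnW | exact: Fy].
  by move=> [[Ay Fy] Fj]; split=> // i; rewrite ltnS leq_eqVlt => /orP[/eqP->|/Fy].
have H0 s : H s 0 = A by apply/seteqP; split=> [y []//|y Ay]; split.
have sH s j : additive_subgroup (H s j).
  by elim: j => [|j IH]; rewrite ?H0 // HS; exact: subgI.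
have Heq s s' j : (forall i, (i < j)%N -> s i = s' i) -> H s j = H s' j.
  by move=> E; apply/seteqP; split=> y [Ay Fy]; split=> // i ij; [rewrite -E|rewrite E]; auto.
have chain K r : exists s, fin A id (H s r) /\
    forall j, (j < r)%N -> ~ few (H s j) id (F (s j)) K.
  elim: r => [|r [s [[k0 f0] sP]]].
    by exists (fun=> 0); split=> //; apply: finT => x y Ax Ay; rewrite H0; exact: subgB.
  (* As [A] has at most [k0] classes modulo [H s r], more than [k0 * K] classes modulo [F x] leave
     more than [K] of them in [H s r]. *)
  have [x [fx nfx]] := unbd (k0 * K)%N.
  pose s' i := if (i < r)%N then s i else x.
  have E j : (j <= r)%N -> H s' j = H s j.
    by move=> jr; apply: Heq => i ij; rewrite /s' (leq_trans ij jr).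
  have s'r : s' r = x by rewrite /s' ltnn.
  exists s'; split.
    by rewrite HS E // s'r; apply: finI => //; exists k0.
  move=> j; rewrite ltnS leq_eqVlt => /orP[/eqP->|jr]; last first.
    by rewrite E ?(ltnW jr) // /s' jr; exact: sP.
  rewrite s'r E // => fr; apply: nfx; apply: few_trans f0 _ => //.
  by apply: (few_map (m := id)) fr => // y [].
have [d Ad] := cdim_some dimP MT C dA (subg0 sA).
have /choice [s sP] : forall K, exists s, fin A id (H s d.+1) /\
    forall j, (j < d.+1)%N -> ~ few (H s j) id (F (s j)) K by move=> K; exact: chain.
have [U [UU Uinf]] := nonprincipal_ultrafilter.
have C' := star_coding C UU; set c' := star_code c U in C'.
have MT' := ultrapower_model UU MT.
(* The ultraproduct of the [j]-th terms of the chains, where the chain at index [i] has all its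
   steps of index above [i]. *)
pose S j := [set y : nat -> g | U [set i | H (s i) j (y i)]].
pose G j := [set y : nat -> g | U [set i | F (s i j) (y i)]].
have SS j : S j.+1 = S j `&` G j.
  apply/seteqP; split=> y; rewrite /S /G /=.
    by move=> h; split; apply: filterS h => i /=; rewrite HS => -[].
  by move=> [h1 h2]; apply: filterS2 h1 h2 => i /=; rewrite HS.
have S0 : S 0 = star U A by apply/seteqP; split=> y; apply: filterS => i /=; rewrite H0.
have dS j : hdef c' (fun rho => S j (rho 0%N)).
  elim: j => [|j IH]; first by rewrite S0; exact: (hdef_star UU dA).
  rewrite SS; apply: hdef_and => //.
  (* The [j]-th elements of all the chains form a single nonstandard parameter. *)
  exact: (hdef_subst (fun k => if k is 0%N then inr (fun i => s i j) else inl 0%N)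
    (hdef_star UU dF)).
have sS j : additive_subgroup (S j) by exact: (star_subgroup UU (F := fun i => H (s i) j)).
(* A covering by [q] cosets in the ultrapower would fail at every [K] at least [q]; a point outside
   all the cosets is chosen there. *)
have nfS j : (j < d.+1)%N -> ~ fin (S j) id (S j.+1).
  move=> jd [q]; rewrite few_covering //; last exact: subg0.
  move=> [l lP].
  have /choice [y yP] : forall K, exists y, (q <= K)%N -> H (s K) j y /\
      forall i, ~ F (s K j) (y - tnth l i K).
    move=> K; have [qK|qK] := leqP q K; last by exists 0.
    have := (sP K).2 j jd; move=> nf; apply: contrapT => ny; apply: nf.
    apply: few_le qK _; rewrite few_covering //; last exact: subg0.
    exists [tuple tnth l i K | i < q] => y Hy; apply: contrapT => ni.
    apply: ny; exists y => _; split=> // i Fi; apply: ni; exists i.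
    by rewrite tnth_mktuple.
  have Sy : S j y by apply: filterS (Uinf q) => K /yP[].
  have [i] := lP _ Sy; rewrite SS => -[_ Gi].
  have : U [set _ | False] by apply: filterS2 (Uinf q) Gi => K /yP[_]; apply.
  by case/filter_ex.
(* Counting from the bottom, every step up adds at least one to the dimension, so [S 0] gets
   dimension at least [d.+1], against [ddim_star]. *)
have dle i : (i <= d.+1)%N -> dim_le (Some i) (cdim dim c' (S (d.+1 - i)%N)).
  elim: i => [|i IH] le_i.
    rewrite subn0; have [k ->] := cdim_some dimP MT' C' (dS d.+1) (subg0 (sS d.+1)).
    by [].
  have := IH (ltnW le_i); rewrite subSn // subSS => ik.
  have [k kE] := cdim_some dimP MT' C' (dS (d - i).+1) (subg0 (sS (d - i).+1)).
  have h : dim_le (Some k.+1) (cdim dim c' (S (d - i)%N)).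
    apply: (cdim_infinite_index dimP MT' C' _ _ _ _ (dS (d - i).+1)) => //.
    + by rewrite SS => y [].
    + by apply: nfS; rewrite ltnS leq_subr.
  by apply: dim_le_trans h; rewrite kE in ik.
have := dle d.+1 (leqnn _).
rewrite subnn S0 /cdim /c' star_code_img //.
rewrite (ddim_star dimP MT UU); last exact: definable_img dA.
by rewrite -/(cdim dim c A) Ad /= ltnn.
Qed.

End UniformBound.
(** * Lie rings *)

Section LieRing.
Variable g : lieRingType.
Implicit Types (x y z : g) (A B H I J : set g).

(* The axioms of [Defs], restated at the canonical instances: there the head
   operations are unfolded, which blocks rewriting with [zmodType] lemmas. *)
Lemma brDl x y z : bracket (x + y) z = bracket x z + bracket y z.
Proof. exact: bracketDl. Qed.

Lemma brDr x y z : bracket x (y + z) = bracket x y + bracket x z.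
Proof. exact: bracketDr. Qed.

Lemma brC x y : bracket x y = - bracket y x.
Proof. exact: bracketC. Qed.

Lemma bracketNr x y : bracket x (- y) = - bracket x y.
Proof.
have x0 : bracket x 0 = 0 by apply: (addrI (bracket x 0)); rewrite -brDr !addr0.
by apply/eqP; rewrite -addr_eq0 -brDr addNr x0.
Qed.

Lemma bracketNl x y : bracket (- x) y = - bracket x y.
Proof. by rewrite brC bracketNr -brC. Qed.

Lemma bracketBr x y z : bracket x (y - z) = bracket x y - bracket x z.
Proof. by rewrite brDr bracketNr. Qed.

Lemma bracketBl x y z : bracket (x - y) z = bracket x z - bracket y z.
Proof. by rewrite brDl bracketNl. Qed.

Lemma bracket0l x : bracket 0 x = 0.
Proof. by rewrite -{1}(subrr x) bracketBl subrr. Qed.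

Lemma bracket0r x : bracket x 0 = 0.
Proof. by rewrite -{1}(subrr x) bracketBr subrr. Qed.

Lemma bracket_derivation x y z :
  bracket x (bracket y z) = bracket (bracket x y) z + bracket y (bracket x z).
Proof.
have : bracket x (bracket y z) + bracket y (bracket z x) + bracket z (bracket x y) = 0.
  exact: bracket_jacobi.
rewrite (brC z x) bracketNr (brC z (bracket x y)).
by move/eqP; rewrite -addrA -opprD subr_eq0 addrC => /eqP.
Qed.

Lemma idealS I : ideal I -> additive_subgroup I. Proof. by case. Qed.
Lemma ideal0 I : ideal I -> I 0. Proof. by case=> -[]. Qed.
Lemma idealM I x y : ideal I -> I y -> I (bracket x y). Proof. by case=> _; exact. Qed.
Lemma idealMr I x y : ideal I -> I x -> I (bracket x y).
Proof. by move=> iI Ix; rewrite brC; apply: subgN; [exact: idealS | exact: idealM]. Qed.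

Lemma idealI I J : ideal I -> ideal J -> ideal (I `&` J).
Proof.
move=> iI iJ; split=> [|x y [Iy Jy]]; first by apply: subgI; exact: idealS.
by split; exact: idealM.
Qed.

Lemma subg_setT : additive_subgroup [set: g]. Proof. by []. Qed.

(** * Derived series *)

Lemma bracket_set_subgroup A B : additive_subgroup (bracket_set A B).
Proof.
split=> [|x y Ax Ay] S [sS AS]; first exact: subg0.
by apply: subgB => //; [exact: Ax | exact: Ay].
Qed.

Lemma bracket_set_min A B I : additive_subgroup I ->
  (forall x y, A x -> B y -> I (bracket x y)) -> bracket_set A B `<=` I.
Proof. by move=> sI ABI; apply: smallest_sub => // _ [x Ax [y By <-]]; exact: ABI. Qed.

Lemma bracket_set_mem A B x y : A x -> B y -> bracket_set A B (bracket x y).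
Proof. by move=> Ax By; apply: sub_gen_smallest; exists x => //; exists y. Qed.

Lemma bracket_set_mono A A' B B' :
  A `<=` A' -> B `<=` B' -> bracket_set A B `<=` bracket_set A' B'.
Proof.
move=> AA BB; apply: bracket_set_min; first exact: bracket_set_subgroup.
by move=> x y /AA Ax /BB By; exact: bracket_set_mem.
Qed.

(** By the derivation rule, the elements that [bracket x] sends into [bracket_set A B] form a
    subgroup containing the generators. *)
Lemma bracket_set_ideal A B : ideal A -> ideal B -> ideal (bracket_set A B).
Proof.
move=> iA iB; have sS := bracket_set_subgroup A B; split=> // x y Sy.
suff H : bracket_set A B `<=` [set z | bracket_set A B (bracket x z)] by exact: H.
apply: bracket_set_min => [|a b Aa Bb /=].
  split=> [|a b Sa Sb] /=; first by rewrite bracket0r; exact: subg0.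
  by rewrite bracketBr; exact: (subgB sS).
by rewrite bracket_derivation; apply: (subgD sS); apply: bracket_set_mem => //; exact: idealM.
Qed.

Lemma derived_subgroup A k : additive_subgroup A -> additive_subgroup (derived_series A k).
Proof. by case: k => [|k] // _; exact: bracket_set_subgroup. Qed.

Lemma derived_ideal A k : ideal A -> ideal (derived_series A k).
Proof. by move=> iA; elim: k => //= k IH; exact: bracket_set_ideal. Qed.

Lemma derived_mono A B k : A `<=` B -> derived_series A k `<=` derived_series B k.
Proof. by move=> AB; elim: k => //= k IH; exact: bracket_set_mono. Qed.

Lemma derived_add A k l :
  derived_series A (l + k) = derived_series (derived_series A k) l.
Proof. by elim: l => //= l ->. Qed.

Lemma soluble_derived A I k :
  additive_subgroup A -> derived_series A k `<=` I -> soluble I -> soluble A.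
Proof.
move=> sA AI [l lE]; exists (l + k)%N; apply/seteqP; split=> [x|_ ->].
  by rewrite derived_add -lE; exact: derived_mono AI _.
exact: (subg0 (derived_subgroup _ sA)).
Qed.

Definition sumset A B := [set x | exists a b, [/\ A a, B b & x = a + b]].

Lemma sumset_subgroup A B :
  additive_subgroup A -> additive_subgroup B -> additive_subgroup (sumset A B).
Proof.
move=> sA sB; split=> [|_ _ [a [b [Aa Bb ->]]] [a' [b' [Aa' Bb' ->]]]].
  by exists 0, 0; split; rewrite ?addr0 //; exact: subg0.
by exists (a - a'), (b - b'); split; [exact: subgB|exact: subgB|rewrite opprD addrACA].
Qed.

Lemma sumset_ideal A B : ideal A -> ideal B -> ideal (sumset A B).
Proof.
move=> iA iB; split=> [|x _ [a [b [Aa Bb ->]]]]; first by apply: sumset_subgroup; exact: idealS.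
by exists (bracket x a), (bracket x b); split; rewrite ?brDr //; exact: idealM.
Qed.

(** Modulo [B], the derived series of the sum follows that of [A], since brackets with elements of
    [B] stay in [B]; after [k] steps it falls inside [B]. *)
Lemma sumset_soluble A B :
  ideal A -> ideal B -> soluble A -> soluble B -> soluble (sumset A B).
Proof.
move=> iA iB [k kE]; have sS : additive_subgroup (sumset A B).
  by apply: sumset_subgroup; exact: idealS.
have AB l : derived_series (sumset A B) l `<=` sumset (derived_series A l) B.
  elim: l => //= l IH; apply: bracket_set_min.
    by apply: sumset_subgroup; [exact: bracket_set_subgroup | exact: idealS].
  move=> _ _ /IH [a [b [Aa Bb ->]]] /IH [a' [b' [Aa' Bb' ->]]].
  exists (bracket a a'), (bracket b a' + bracket (a + b) b').
  split; first exact: bracket_set_mem.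
    by apply: subgD; [exact: idealS | exact: idealMr | exact: idealM].
  by rewrite [LHS]brDr brDl addrA.
apply: (soluble_derived (k := k)) => // x /AB [a [b [+ Bb ->]]].
by rewrite kE => ->; rewrite add0r.
Qed.

(** * Almost centralizers *)

(** For an ideal [I], the centralizer of [x] modulo [I]. *)
Definition residual I x := [set y | I (bracket x y)].

Definition almost_centralizer H I := [set x | fin H id (residual I x)].

Lemma residual_subgroup I x : additive_subgroup I -> additive_subgroup (residual I x).
Proof.
move=> sI; rewrite /residual; split=> [|y z Iy Iz] /=; first by rewrite bracket0r; exact: subg0.
by rewrite bracketBr; exact: subgB.
Qed.

Lemma sub_almost_centralizer H I : ideal I -> I `<=` almost_centralizer H I.
Proof. by move=> iI x Ix; apply: finT => y z _ _; exact: idealMr. Qed.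

Lemma almost_centralizer_subgroup H I :
  ideal I -> additive_subgroup (almost_centralizer H I).
Proof.
move=> iI; split=> [|x y Hx Hy].
  by apply: sub_almost_centralizer => //; exact: ideal0.
apply: finS (finI Hx Hy) => // z [Iz Iz'].
by rewrite /residual /= bracketBl; exact: (subgB (idealS iI)).
Qed.

(** Use [[y, x], z] = [y, [x, z]] - [x, [y, z]]. The first term is in [I] for [z] in a part of
    finite index; so is the second, because [bracket y] sends a part of [H] of finite index into
    [H]. *)
Lemma almost_centralizer_ideal H I :
  additive_subgroup H -> ideal I -> (forall y, fin H id [set z | H (bracket y z)]) ->
  ideal (almost_centralizer H I).
Proof.
move=> sH iI aH; split=> [|y x Hx]; first exact: almost_centralizer_subgroup.
have f1 : fin (H `&` [set z | H (bracket y z)]) id [set z | I (bracket x (bracket y z))].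
  apply: (fin_preim (m := bracket y)) Hx => [z []//|z w _ _].
  by rewrite /residual /= -bracketBr.
have f2 := fin_trans sH (aH y) f1.
apply: finS (finI Hx f2) => // z [Iz Iyz].
rewrite /residual /= in Iz Iyz *.
have /eqP := bracket_derivation y x z; rewrite -subr_eq => /eqP <-.
by apply: (subgB (idealS iI)) => //; exact: idealM.
Qed.

(* Bilinear form of B. H. Neumann's theorem on groups with boundedly finite
   conjugacy classes: the brackets of elements of [A] meet finitely many cosets
   of [I]. *)
Lemma fin_brackets A I k :
  additive_subgroup A -> additive_subgroup I ->
  (forall x, A x -> few A id (residual I x) k) ->
  fin [set p : g * g | A p.1 /\ A p.2] (fun p => bracket p.1 p.2) I.
Proof.
move=> sA sI Ak.
have finA x : A x -> fin A id (residual I x) by move=> Ax; exists k; exact: Ak.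
pose sepA x s := [/\ A x, forall w, w \in s -> A w & separated (residual I x) s].
(* The largest such [m] counts the elements of [A] that can be separated modulo the centralizer of a
   single element; [k] bounds it. *)
pose P m := `[< exists x s, sepA x s /\ size s = m >].
have exP : exists m, P m.
  exists 0%N; apply/asboolP; exists 0, [::]; split=> //; split=> //; first exact: subg0.
  by move=> i j; rewrite ltn0 andbF.
have bndP m : P m -> (m <= k)%N.
  by move=> /asboolP [x [s [[Ax As sep] <-]]]; exact: separated_few (Ak x Ax) As sep.
case: (ex_maxnP exP bndP) => m /asboolP [x [s [[Ax As sep] sm]]] mmax.
(* By maximality, once [s] is separated for [y] it meets every coset in [A] of the centralizer of
   [y]. *)
have covers y : sepA y s -> forall v, A v -> exists2 w, w \in s & I (bracket y (w - v)).
  move=> [Ay _ sepy] v Av; apply: contrapT => nw.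
  suff /mmax : P m.+1 by rewrite ltnn.
  apply/asboolP; exists y, (rcons s v); rewrite size_rcons sm; split=> //; split=> //.
    by move=> w; rewrite mem_rcons inE => /orP[/eqP->|/As].
  by apply: separated_rcons => // w ws Iw; apply: nw; exists w.
pose A0 := A `&` [set y | forall w, w \in s -> I (bracket y w)].
have finA0 : fin A id A0.
  apply: finI; first by apply: finT => y z; exact: subgB.
  apply: (fin_bigcap (F := fun w => [set y | I (bracket y w)])) => w ws.
  apply: finS (finA w (As w ws)) => // y; rewrite /residual /= brC.
  by move/(subgN sI); rewrite opprK.
(* Adding to [x] an element that centralizes [s] modulo [I] keeps [s] separated. *)
have A0P y v : A0 y -> A v -> exists2 w, w \in s & I (bracket (x + y) (w - v)).
  move=> [Ay Iy]; apply: covers; split=> //; first exact: subgD.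
  move=> i j ij; move/andP: (ij) => [ij1 js].
  rewrite /residual /= brDl => Ixy; apply: (sep i j ij); rewrite /residual /=.
  have Iyij : I (bracket y (nth 0 s i - nth 0 s j)).
    by rewrite bracketBr; apply: subgB => //; apply: Iy; apply: mem_nth => //; exact: ltn_trans js.
  by have := subgB sI Ixy Iyij; rewrite (addrK (bracket y _)).
(* For fixed [w], [y, v] is congruent to [x, w - v] modulo [I], so its class depends only on the
   coset of [v] modulo [residual I x]. *)
have fin0 : fin [set p : g * g | A0 p.1 /\ A p.2] (fun p => bracket p.1 p.2) I.
  have : forall w, w \in s -> fin [set p : g * g | [/\ A0 p.1, A p.2 &
      I (bracket (x + p.1) (w - p.2))]] (fun p => bracket p.1 p.2) I.
    move=> w ws; apply: (fin_preim (m := snd)) (finA x Ax) => [[y v] []//|].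
    move=> [y v] [y' v'] [/= [_ Iy] _ Iw] [/= [_ Iy'] _ Iw'].
    have E z t : I (bracket z w) -> I (bracket (x + z) (w - t)) ->
        I (bracket x (w - t) - bracket z t).
      move=> Iz; rewrite brDl [bracket z (w - t)]bracketBr addrCA addrC => Ixz.
      by have := subgB sI Ixz Iz; rewrite (addrK (bracket z w)).
    rewrite /residual /= => Ivv'.
    apply: (subgBt sI) (subgBC sI (E _ _ (Iy w ws) Iw)) _.
    apply: (subgBt sI) (E _ _ (Iy' w ws) Iw').
    by rewrite -bracketBr opprB addrC subrKA -opprB bracketNr; exact: subgN.
  move/fin_bigcup; apply: finS => // -[y v] /= [Ay Av].
  by have [w ws Iw] := A0P y v Ay Av; exists w.
(* Passage from [A0] to [A]: with a representative [b] of [u], [u, v] = [b, v] + [u - b, v]. *)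
have [t [tA tP]] := fin_reps finA0.
have : forall b, b \in t -> fin [set p : g * g | [/\ A p.1, A p.2 & A0 (p.1 - b)]]
    (fun p => bracket b p.2 + bracket (p.1 - b) p.2) I.
  move=> b bt; apply: fin_add => //.
    apply: (fin_preim (m := snd)) (finA b (tA b bt)) => [[y v] []//|[y v] [y' v'] _ _].
    by rewrite /residual /= bracketBr.
  by apply: (fin_preim (m := fun p => (p.1 - b, p.2))) fin0 => [[y v] []|].
move=> H; have {H} : forall b, b \in t -> fin [set p : g * g | [/\ A p.1, A p.2 & A0 (p.1 - b)]]
    (fun p => bracket p.1 p.2) I.
  move=> b /H; apply: (fin_preim (m := id)) => // p q _ _.
  by rewrite -!brDl ![b + _]addrC !subrK.
move/fin_bigcup; apply: finS => // -[u v] /= [Au Av].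
by have [b bt [? ?]] := tP u Au; exists b.
Qed.

End LieRing.
(** * The radical *)

Section NilpotentSubideal.
Variable g : lieRingType.
Implicit Types A I : set g.

(* The centralizer in [A], modulo [I], of the derived ideal of [A]. *)
Definition central_part A I :=
  [set x | A x /\ forall u v : g, A u -> A v -> I (bracket x (bracket u v))].

Lemma central_part_ideal A I : ideal A -> ideal I -> ideal (central_part A I).
Proof.
move=> iA iI; have [sA sI] := (idealS iA, idealS iI); split.
  split=> [|x y [Ax Ix] [Ay Iy]].
    by split=> [|u v _ _]; [exact: subg0 | rewrite bracket0l; exact: subg0].
  split=> [|u v Au Av]; first exact: subgB.
  by rewrite bracketBl; apply: subgB => //; [exact: Ix | exact: Iy].
move=> y x [Ax Ix]; split=> [|u v Au Av]; first exact: idealM.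
have /eqP := bracket_derivation y x (bracket u v); rewrite -subr_eq => /eqP <-.
apply: subgB => //; first by apply: idealM => //; exact: Ix.
rewrite (bracket_derivation y u v) brDr.
by apply: subgD => //; apply: Ix => //; exact: idealM.
Qed.

(** Write C for the central part. Then [C, C] lies both in C and in [A, A], which C centralizes
    modulo [I]; so the brackets of elements of [C, C] fall in [I]. *)
Lemma central_part_derived A I : ideal A -> ideal I ->
  derived_series (central_part A I) 2 `<=` I.
Proof.
move=> iA iI; have iC := central_part_ideal iA iI; have sI := idealS iI.
apply: bracket_set_min => // x y Cx Cy.
have {Cx} Cx : central_part A I x.
  by apply: bracket_set_min Cx; [exact: idealS | move=> u v _; exact: idealM].
suff H : bracket_set (central_part A I) (central_part A I) `<=` residual I x by exact: H.
apply: bracket_set_min; first exact: residual_subgroup.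
by move=> u v [Au _] [Av _]; apply: Cx.2.
Qed.

(** By [fin_brackets], centralizing finitely many brackets modulo [I] is enough, and each of them
    lies in [A], so its centralizer has finite index. *)
Lemma fin_central_part A I k : ideal A -> ideal I ->
  (forall x, A x -> few A id (residual I x) k) -> fin A id (central_part A I).
Proof.
move=> iA iI Ak; have [sA sI] := (idealS iA, idealS iI).
have [r [rA rP]] := fin_reps (fin_brackets sA sI Ak).
have : fin A id ([set: g] `&` [set x | forall p, p \in r -> I (bracket x (bracket p.1 p.2))]).
  apply: finI; first exact: finT.
  apply: (fin_bigcap (F := fun p : g * g => [set x | I (bracket x (bracket p.1 p.2))])) => p pr.
  have [A1 A2] := rA p pr.
  have : fin A id (residual I (bracket p.1 p.2)) by exists k; apply: Ak; exact: idealM.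
  apply: finS => // x; rewrite /residual /= brC => /(subgN sI).
  by rewrite opprK.
have finA : fin A id A by apply: finT => x y; exact: subgB.
move=> /(finI finA); apply: finS => // x [Ax [_ Ix]]; split=> // u v Au Av.
have [p pr Ip] := rP (u, v) (conj Au Av).
rewrite /= in Ip; apply: (subgBK sI) (Ix p pr) _.
by rewrite -bracketBr; exact: idealM.
Qed.

End NilpotentSubideal.

(** Injectivity of [c] recovers the arguments of an operation from a point of its coded graph. *)
Lemma definable_lie_coding (L : language) (M : structure L) (g : lieRingType) (n : nat)
    (c : g -> n.-tuple M) :
  definable_lie_ring c ->
  coding c /\ hdef c (fun rho => c (rho 2%N) = c (bracket (rho 0%N) (rho 1%N))).
Proof.
case=> cinj dr dadd dbr.
have E (op : g -> g -> g) : definable [set cat_tuple (cat_tuple (c x) (c y)) (c (op x y))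
      | x in [set: g] & y in [set: g]] ->
    hdef c (fun rho => c (rho 2%N) = c (op (rho 0%N) (rho 1%N))).
  move=> /(hdef_definable3 c); apply: hdef_ext => rho; split.
    move=> [x _ [y _ E]].
    have E1 := congr1 (fun t => lpart (lpart t)) E; have E2 := congr1 (fun t => rpart (lpart t)) E.
    have E3 := congr1 (@rpart _ _ _) E.
    rewrite !lpart_cat in E1; rewrite !lpart_cat !rpart_cat in E2; rewrite !rpart_cat in E3.
    by rewrite -E3 (cinj _ _ E1) (cinj _ _ E2).
  by move=> ->; exists (rho 0%N) => //; exists (rho 1%N).
split; last exact: E.
split=> //; last exact: E.
by move=> x y t /cinj ->.
Qed.

(** * Definable Lie rings of finite dimension *)

Section Radical.
Variables (L : language) (T : theory L).
Variable dim : forall (M : structure L) (n : nat), set (set (n.-tuple M)) -> dimension.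
Hypothesis dimP : is_dimension T dim.
Variables (M : structure L) (MT : is_model T M).
Variables (g : lieRingType) (n : nat) (c : g -> n.-tuple M).
Hypothesis cinj : injective c.
Hypothesis C : coding c.
Hypothesis dbr : hdef c (fun rho => c (rho 2%N) = c (bracket (rho 0%N) (rho 1%N))).
Implicit Types (A H I J K : set g).

Local Notation def A := (hdef c (fun rho => A (rho 0%N))).

Lemma hterm_bracket t u : hterm c t -> hterm c u -> hterm c (fun rho => bracket (t rho) (u rho)).
Proof. exact: hterm_app2. Qed.

Lemma hdef_residual I : def I -> hdef c (fun rho => residual I (rho 0%N) (rho 1%N)).
Proof. by move=> dI; apply: hdef_app1 => //; apply: hterm_bracket; exact: hterm_var. Qed.

Lemma def_residual I x : def I -> def (residual I x).
Proof.
move=> /hdef_residual.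
exact: (hdef_subst (fun i => if i is 0%N then inr x else inl 0%N)).
Qed.

Lemma def_central_part A I : def A -> def I -> def (central_part A I).
Proof.
move=> dA dI; apply: hdef_and => //.
apply: hdef_all => //; apply: hdef_all => //.
apply: hdef_imp; first exact: (hdef_ren (fun=> 1%N) dA).
apply: hdef_imp => //; apply: hdef_app1 => //.
by do 2?[apply: hterm_bracket; first exact: hterm_var]; exact: hterm_var.
Qed.

Lemma residual_bound H I : additive_subgroup H -> ideal I -> def H -> def I ->
  exists k, forall x, fin H id (residual I x) -> few H id (residual I x) k.
Proof.
move=> sH iI dH dI; apply: (uniform_index_bound dimP MT C) => //.
  by move=> x; apply: residual_subgroup; exact: idealS.
exact: hdef_residual.
Qed.

(** The uniform bound replaces finite index by index at most [k], which is first-order by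
    [hdef_few]. *)
Lemma def_almost_centralizer H I : additive_subgroup H -> ideal I -> def H -> def I ->
  def (almost_centralizer H I).
Proof.
move=> sH iI dH dI; have [k kP] := residual_bound sH iI dH dI.
have d := hdef_few C k (fun x => residual_subgroup x (idealS iI)) (subg0 sH) dH (hdef_residual dI).
apply: hdef_ext d => rho; split=> [?|/kP//].
by exists k.
Qed.

(** Otherwise take [k.+1] elements of [H] separated modulo [almost_centralizer A I]. Their
    differences have centralizers of infinite index in [A], so by [not_covered] some [y] in [A]
    avoids all of these. The elements are then separated for [residual I y], against the bound
    [k]. *)
Lemma fin_almost_centralizer_sym H A I :
  additive_subgroup H -> additive_subgroup A -> ideal I -> def H -> def A -> def I ->
  A `<=` almost_centralizer H I -> fin H id (almost_centralizer A I).
Proof.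
move=> sH sA iI dH dA dI AH; apply: contrapT => nfin.
have [k kP] := residual_bound sH iI dH dI.
have [s [sk sHs sep]] := not_fin_separated (almost_centralizer_subgroup A iI) (subg0 sH) nfin k.+1.
pose diffs := [seq nth 0 s p.1 - nth 0 s p.2 |
  p : 'I_k.+1 * 'I_k.+1 <- enum {: 'I_k.+1 * 'I_k.+1} & (p.1 < p.2)%N].
have [|y Ay yP] := not_covered dimP MT C (F := residual I) (s := diffs) sA dA.
  move=> d /mapP [[i j]]; rewrite mem_filter /= => /andP[ij _] ->; split.
  - exact/residual_subgroup/idealS.
  - exact: def_residual.
  - by apply: sep; rewrite ij sk ltn_ord.
suff : (size s <= k)%N by rewrite sk ltnn.
apply: separated_few (kP y (AH y Ay)) sHs _ => i j /andP[ij js] Iy.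
have jk : (j < k.+1)%N by rewrite -sk.
apply: (yP (nth 0 s i - nth 0 s j)).
  apply/mapP; exists (Ordinal (ltn_trans ij jk), Ordinal jk) => //.
  by rewrite mem_filter /= ij mem_enum.
by rewrite /residual /= brC; exact: (subgN (idealS iI) Iy).
Qed.

Definition solid I := [/\ ideal I, soluble I & def I].

Lemma solid0 : solid [set 0].
Proof.
split.
- split=> [|x y ->]; last exact: bracket0r.
  by split=> // x y -> ->; rewrite subr0.
- by exists 0%N.
- have d : hdef c (fun rho => c (rho 0%N) = c 0) by exact: (hterm_const c 0).
  by apply: hdef_ext d => rho; split=> [/cinj|->].
Qed.

Lemma maximal_solid : exists2 I, solid I &
  forall K, solid K -> I `<=` K -> fin K id I.
Proof.
pose P d := `[< exists2 I, solid I & cdim dim c I = Some d >].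
have some I : solid I -> exists d, cdim dim c I = Some d.
  by move=> [iI _ dI]; apply: (cdim_some dimP MT C dI (x := 0)); exact: ideal0.
have exP : exists d, P d.
  by have [d dE] := some _ solid0; exists d; apply/asboolP; exists [set 0] => //; exact: solid0.
have dT : def [set: g] by exact: hdef_True.
(* Here [I] is the proof of [True], to which [[set: g] 0] unfolds. *)
have [D DE] := cdim_some dimP MT C dT (x := 0) I.
have bnd d : P d -> (d <= D)%N.
  move=> /asboolP [I [_ _ dI] dE].
  by have := cdim_mono dimP MT C dI dT (@subsetT _ I); rewrite dE DE.
case: (ex_maxnP exP bnd) => m /asboolP [I sI Im] mmax.
exists I => // K sK IK; apply: contrapT => nfin.
have [d dE] := some K sK.
have [[iI _ dI] [iK _ dK]] := (sI, sK).
have := cdim_infinite_index dimP MT C (idealS iK) (idealS iI) IK dK dI nfin Im.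
rewrite dE /= leqNgt ltnS mmax //; apply/asboolP.
by exists K.
Qed.

(** * Comparison with a maximal definable soluble ideal *)

Section MaximalSolid.
Variable I : set g.
Hypothesis sI : solid I.
Hypothesis Imax : forall K, solid K -> I `<=` K -> fin K id I.

Let iI : ideal I. Proof. by case: sI. Qed.
Let dI : def I. Proof. by case: sI. Qed.
Let solI : soluble I. Proof. by case: sI. Qed.

(** The central part has finite index in [A], and it is a definable soluble ideal above [I], hence
    finite over [I] by maximality. *)
Lemma fin_almost_abelian A : ideal A -> def A -> I `<=` A ->
  A `<=` almost_centralizer A I -> fin A id I.
Proof.
move=> iA dA IA AA; have sA := idealS iA.
have [k kP] := residual_bound sA iI dA dI.
have fC : fin A id (central_part A I).
  by apply: (@fin_central_part _ _ _ k) => // x /AA; exact: kP.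
apply: fin_trans fC _ => //.
have iC := central_part_ideal iA iI.
apply: finS (Imax (K := central_part A I) _ _) => [x []//|//||].
  split=> //; last exact: def_central_part.
  apply: (soluble_derived (k := 2) (I := I)) => //; first exact: idealS.
  exact: central_part_derived.
by move=> x Ix; split=> [|u v _ _]; [exact: IA | exact: idealMr].
Qed.

Let Z := almost_centralizer [set: g] I.

Lemma ideal_Z : ideal Z.
Proof. by apply: almost_centralizer_ideal => // y; exact: finT. Qed.

Lemma fin_Z : fin Z id I.
Proof.
apply: fin_almost_abelian; first exact: ideal_Z.
- by apply: def_almost_centralizer => //; exact: hdef_True.
- exact: sub_almost_centralizer.
- by move=> x; exact: finS.
Qed.

Lemma ideal_sub_Z J : ideal J -> bracket_set J J `<=` Z -> J `<=` Z.
Proof.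
move=> iJ J'Z.
(* [bracket x] maps [J] into [J, J], inside [Z], which is finite over [I]. *)
have finJ x : J x -> fin J id (residual I x).
  move=> Jx; apply: (fin_preim (m := bracket x)) fin_Z => [y Jy|y z _ _].
    by apply: J'Z; exact: bracket_set_mem.
  by rewrite /residual /= -bracketBr.
have dT : def [set: g] by exact: hdef_True.
have sR x : J x -> additive_subgroup (residual I x) /\ def (residual I x).
  by move=> _; split; [exact/residual_subgroup/idealS | exact: def_residual].
have [s [sJ]] := chain_condition dimP MT C (@subg_setT g) dT sR.
set H := [set y | _] => -[sH dH Hfin].
have JH : fin J id H.
  have h1 : fin J id [set: g] by exact: finT.
  have h2 := fin_bigcap (fun x xs => finJ x (sJ x xs)).
  by apply: finS (finI h1 h2).
(* For [x] in [s], [x, [y, z]] = [[x, y], z] + [y, [x, z]]. The last term is in [I] for [z] in [H],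
   and [x, y] lies in [J], so its centralizer has finite index in [H]. *)
have aH y : fin H id [set z | H (bracket y z)].
  have : fin H id [set z | forall x, x \in s -> I (bracket x (bracket y z))].
    apply: (fin_bigcap (F := fun x => [set z | I (bracket x (bracket y z))])) => x xs.
    have : fin H id (H `&` residual I (bracket x y)).
      apply: finI; first by apply: finT => u v; exact: subgB.
      by apply: Hfin; apply: idealMr => //; exact: sJ.
    apply: finS => // z [[_ Hz] Iz].
    rewrite /= bracket_derivation; apply: subgD => //; first exact: idealS.
    by apply: idealM => //; exact: Hz.
  by apply: finS.
pose Y := almost_centralizer H I.
have iY : ideal Y by exact: almost_centralizer_ideal.
have dY : def Y by exact: def_almost_centralizer.
have sY := idealS iY.
pose W := almost_centralizer Y I.
have iW : ideal W.
  apply: almost_centralizer_ideal => // y; apply: finT => u v Yu Yv.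
  by apply: idealM => //; exact: subgB.
have dW : def W by exact: def_almost_centralizer.
have fW : fin H id W by exact: fin_almost_centralizer_sym.
have fWY : fin (W `&` Y) id I.
  apply: fin_almost_abelian; first exact: idealI.
  - exact: hdef_and.
  - by move=> x Ix; split; exact: sub_almost_centralizer.
  - by move=> x [Wx _]; apply: finS Wx => // y [].
(* [J] lies in [Y] by the choice of [H]; up to finite index it lies in [H], and hence in [W]. *)
have fJ : fin J id I.
  apply: (fin_trans (B := W `&` Y)); first exact: idealS.
    apply: finI.
      apply: fin_trans JH _; first exact: idealS.
      by apply: finS fW => // y [].
    have JY : J `<=` Y by move=> x; exact: Hfin.
    by apply: finT => x y Jx Jy; apply: JY; apply: subgB => //; exact: idealS.
  by apply: finS fWY => // y [].
(* [bracket x] maps the whole ring into [J], now finite over [I]. *)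
move=> x Jx; apply: (fin_preim (m := bracket x)) fJ => [y _|y z _ _]; first exact: idealMr.
by rewrite /residual /= -bracketBr.
Qed.

(** The last term of the derived series is zero, and [ideal_sub_Z] climbs back one step at a
    time. *)
Lemma soluble_sub_Z J : ideal J -> soluble J -> J `<=` Z.
Proof.
move=> iJ [k kE].
have : derived_series J k `<=` Z by rewrite kE => _ ->; exact: (ideal0 ideal_Z).
elim: k {kE} => // k IH h; apply: IH.
by apply: ideal_sub_Z => //; exact: derived_ideal.
Qed.

Lemma radical_sub_Z : radical g `<=` Z.
Proof.
move=> _ [s [sP ->]]; apply: subg_sum; first exact/idealS/ideal_Z.
by move=> y /sP [J [iJ solJ Jy]]; exact: soluble_sub_Z Jy.
Qed.

End MaximalSolid.

Lemma soluble_sub_radical J : ideal J -> soluble J -> J `<=` radical g.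
Proof.
move=> iJ solJ x Jx; exists [:: x]; rewrite big_seq1; split=> // y.
by rewrite inE => /eqP ->; exists J.
Qed.

(** Each element of the radical is a finite sum of elements of soluble ideals; these are added to
    [I] one at a time, by [sumset_soluble]. *)
Lemma radical_seq (s : seq g) I : ideal I -> soluble I -> (forall y, y \in s -> radical g y) ->
  exists K, [/\ ideal K, soluble K, I `<=` K & forall y, y \in s -> K y].
Proof.
have seqP (t : seq g) J : ideal J -> soluble J ->
    (forall y, y \in t -> exists I : set g, [/\ ideal I, soluble I & I y]) ->
    exists K, [/\ ideal K, soluble K, J `<=` K & forall y, y \in t -> K y].
  move=> iJ sJ; elim: t => [_|y t IH tP]; first by exists J; split=> // y; rewrite in_nil.
  have [|K [iK sK JK tK]] := IH; first by move=> z zt; apply: tP; rewrite inE zt orbT.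
  have [K' [iK' sK' K'y]] := tP y (mem_head _ _).
  exists (sumset K K'); split; [exact: sumset_ideal | exact: sumset_soluble | |].
    by move=> z /JK Kz; exists z, 0; split; rewrite ?addr0 //; exact: (ideal0 iK').
  move=> z; rewrite inE => /orP[/eqP->|/tK Kz].
    by exists 0, y; split; rewrite ?add0r //; exact: (ideal0 iK).
  by exists z, 0; split; rewrite ?addr0 //; exact: (ideal0 iK').
move=> iI sI; elim: s => [_|y s IH sP]; first by exists I; split=> // y; rewrite in_nil.
have [|K [iK sK IK Ks]] := IH; first by move=> z zs; apply: sP; rewrite inE zs orbT.
have [t [tP yE]] := sP y (mem_head _ _).
have [K' [iK' sK' KK' tK']] := seqP t K iK sK tP.
exists K'; split=> //; first exact: subset_trans KK'.
move=> z; rewrite inE => /orP[/eqP->|/Ks/KK'//].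
by rewrite yE; apply: subg_sum => //; exact: idealS.
Qed.

(** The radical lies in [Z], so it is finite over [I]; a soluble ideal [K] containing [I] and the
    coset representatives is then the whole radical. *)
Theorem radical_soluble_definable : soluble (radical g) /\ definable (c @` radical g).
Proof.
have [I sI Imax] := maximal_solid; have [iI solI dI] := sI.
have fR : fin (radical g) id I by apply: finS (fin_Z sI Imax) => //; exact: radical_sub_Z.
have [r [rR rP]] := fin_reps fR.
have [K [iK solK IK rK]] := radical_seq iI solI rR.
have RK : radical g = K.
  apply/seteqP; split=> [x /rP [y yr Ixy]|]; last exact: soluble_sub_radical.
  by apply: subgBK (rK y yr) (IK _ Ixy); exact: idealS.
split; first by rewrite RK.
apply: hdef_definable_img; first exact: coding_range.
(* A finite union of cosets of [I], with the representatives as parameters. *)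
have d : hdef c (fun rho => exists2 y, y \in r & I (rho 0%N - y)).
  apply: hdef_has => y; apply: hdef_app1 => //.
  by apply: (hterm_sub C); [exact: hterm_var | exact: hterm_const].
apply: hdef_ext d => rho; split=> [[y yr Iy]|]; last exact: rP.
by rewrite RK; apply: subgBK (rK y yr) (IK _ Iy); exact: idealS.
Qed.

End Radical.

Theorem theorem8p12 (L : language) (T : theory L) (M : structure L)
    (g : lieRingType) (n : nat) (c : g -> n.-tuple M) :
  finite_dimensional T -> is_model T M -> definable_lie_ring c ->
  soluble (radical g) /\ definable (c @` radical g).
Proof.
move=> [dim dimP] MT cP; have [C dbr] := definable_lie_coding cP.
by apply: (radical_soluble_definable dimP MT) => //; case: cP.
Qed.
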